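(* Fix positive integers $r,s$, put $n=r+s$, and let $\mathfrak{C}=(b_0,a_1,\dots,a_{n-1})\in k^n$. For each $i\in\{1,\dots,n\}$ with $(q-1)\mid i$, let $h_i$ be the greatest integer with $(q^{h_i}-1)\mid i$ and write $i=p^{\ell_i}n_i(q^{h_i}-1)$ with $p\nmid n_i$. Put $a=\prod(t^{q^{h_i}}-t)^{p^{\ell_i}}\in\mathbb{F}_q[t]$, the product over all $i\in\{1,\dots,n\}$ divisible by $q-1$. Then $M_\mathfrak{C}$ represents an $\mathbb{F}_q[t]$-torsion class in $\mathrm{Ext}^1_{\mathscr{F}}(\mathbf{1},M')$ if and only if $\rho_a(\mathbf{v}_\mathfrak{C})=0$.
   Context: $q$ is a power of a prime $p$; $A=\mathbb{F}_q[\theta]$, $k=\mathbb{F}_q(\theta)$, $k_\infty=\mathbb{F}_q((1/\theta))$, $\mathbb{C}_\infty$ the completion of an algebraic closure of $k_\infty$, $\bar k$ the algebraic closure of $k$ in it. Let $D_0=1$, $D_i=\prod_{j=0}^{i-1}(\theta^{q^i}-\theta^{q^j})$; for $m=\sum m_iq^i$ ($0\le m_i\le q-1$) put $\Gamma_{m+1}=\prod_iD_i^{m_i}$. With $t$ a new variable, $G_0(y)=1$, $G_m(y)=\prod_{i=1}^m(t^{q^m}-y^{q^i})$, the Anderson–Thakur polynomials $H_m\in A[t]$ are defined by $\bigl(1-\sum_{i\ge0}\frac{G_i(\theta)}{D_i|_{\theta=t}}x^{q^i}\bigr)^{-1}=\sum_{m\ge0}\frac{H_m}{\Gamma_{m+1}|_{\theta=t}}x^m$.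 For $f=\sum c_it^i$, $f^{(-1)}=\sum c_i^{1/q}t^i$. $\bar k[t,\sigma]$ is the noncommutative $\bar k[t]$-algebra generated by $\sigma$ with $\sigma f=f^{(-1)}\sigma$; a Frobenius module is a left $\bar k[t,\sigma]$-module free of finite rank over $\bar k[t]$; $\mathscr{F}$ is their category; $\mathbf{1}$ is $\bar k[t]$ with $\sigma f=f^{(-1)}$. A Frobenius module is defined by $\Phi\in\mathrm{Mat}_m(\bar k[t])$ if it has a $\bar k[t]$-basis $f_1,\dots,f_m$ with $\sigma(f_1,\dots,f_m)^T=\Phi(f_1,\dots,f_m)^T$. If $M'$ is defined by $\Phi'$ and $M$ by $\begin{pmatrix}\Phi'&0\\ \mathbf{v}&1\end{pmatrix}$, $M$ gives a class in $\mathrm{Ext}^1_{\mathscr{F}}(\mathbf{1},M')$, an $\mathbb{F}_q[t]$-module in which sums add the rows $\mathbf{v}$ and $c\in\mathbb{F}_q[t]$ multiplies $\mathbf{v}$ by $c$. $M'$ is the Frobenius module with $\bar k[t]$-basis $x_0,\dots,x_{n-1}$ and $\sigma x_0=(t-\theta)^nx_0$, $\sigma x_i=H_{i-1}^{(-1)}(t-\theta)^nx_0+(t-\theta)^{n-i}x_i$ ($1\le i\le n-1$); let $\Phi'$ be its matrix. Given $\mathfrak{C}$, let $\Gamma_\mathfrak{C}\in A$ be the monic lcm of the denominators of $\{a_i/(\Gamma_i\Gamma_{n-i})\}_{i=1}^{n-1}\cup\{b_0/\Gamma_n,1/(\Gamma_r\Gamma_s)\}$, $\alpha_i=\frac{a_i\Gamma_\mathfrak{C}}{\Gamma_i\Gamma_{n-i}}|_{\theta=t}$,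 $\beta_0=\frac{b_0\Gamma_\mathfrak{C}}{\Gamma_n}|_{\theta=t}$, $\gamma_0=\frac{\Gamma_\mathfrak{C}}{\Gamma_r\Gamma_s}|_{\theta=t}$. $M_\mathfrak{C}$ is defined by $\begin{pmatrix}\Phi'&0\\ (f_0,\dots,f_{n-1})&1\end{pmatrix}$ with $f_0=\beta_0H_{n-1}^{(-1)}(t-\theta)^n-\gamma_0H_{r-1}^{(-1)}H_{s-1}^{(-1)}(t-\theta)^n$ and $f_j=\alpha_jH^{(-1)}_{(n-j)-1}(t-\theta)^{n-j}$ for $1\le j\le n-1$. $M'$ is free over $\bar k[\sigma]$ with basis $\nu_1,\dots,\nu_d$ ($d=n(n+1)/2$) equal to $(t-\theta)^{n-1}x_0,\dots,(t-\theta)x_0,x_0,(t-\theta)^{n-2}x_1,\dots,x_1,\dots,(t-\theta)x_{n-2},x_{n-2},x_{n-1}$. Define $\Delta:M'\to\mathrm{Mat}_{d\times1}(\bar k)$ by $\Delta(\sum_iu_i\nu_i)=(\delta(u_1),\dots,\delta(u_d))^T$ where $\delta(\sum_j\sigma^jc_j)=\sum_jc_j$ for $c_j\in\bar k$. It is known that $\Delta$ induces an isomorphism $M'/(\sigma-1)M'\cong\mathrm{Mat}_{d\times1}(\bar k)$ and that there is an $\mathbb{F}_q$-linear ring homomorphism $\rho:\mathbb{F}_q[t]\to\mathrm{Mat}_d(\bar k[\tau])$ ($\tau$ the $q$-th power Frobenius, $\tau c=c^q\tau$) with $\Delta(tm)=\rho_t(\Delta(m))$; $(E',\rho)$ is the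 resulting $t$-module with $E'(\bar k)=\mathrm{Mat}_{d\times1}(\bar k)$, and the map sending a class with row $(f_0,\dots,f_{n-1})$ to $\sum f_ix_i$ is an $\mathbb{F}_q[t]$-isomorphism $\mathrm{Ext}^1_{\mathscr{F}}(\mathbf{1},M')\cong M'/(\sigma-1)M'$. Set $\mathbf{v}_\mathfrak{C}:=\Delta(\sum_{i=0}^{n-1}f_ix_i)\in E'(\bar k)$ (it lies in $E'(A)$). *)

(* Defs.v *)
From HB Require Import structures.
From mathcomp Require Import all_boot all_order all_fingroup all_algebra all_field.

Set Implicit Arguments.
Unset Strict Implicit.
Unset Printing Implicit Defensive.

Import GRing.Theory.
Local Open Scope ring_scope.

Notation "x %:F" := (FracField.tofrac x) : ring_scope.

(** R[tau; phi], with  tau c = phi(c) tau.  The left-normal form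
    sum_i c_i tau^i  is stored as the polynomial with coefficients c_i. *)

Record skew_poly (R : nzRingType) (phi : {rmorphism R -> R}) :=
  SkewPoly { skew_val : {poly R} }.
Arguments SkewPoly {R} phi skew_val.

Section SkewPolyRing.
Variables (R : nzRingType) (phi : {rmorphism R -> R}).
Local Notation skew := (skew_poly phi).

HB.instance Definition _ := [isNew of skew for @skew_val R phi].
HB.instance Definition _ := [Choice of skew by <:].

Definition sadd (p q : skew) := SkewPoly phi (skew_val p + skew_val q).
Definition sopp (p : skew) := SkewPoly phi (- skew_val p).
Fact saddA : associative sadd.
Proof. by move=> p q r; apply: val_inj; apply: addrA. Qed.
Fact saddC : commutative sadd.
Proof. by move=> p q; apply: val_inj; apply: addrC. Qed.
Fact sadd0 : left_id (SkewPoly phi 0) sadd.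
Proof. by move=> p; apply: val_inj; apply: add0r. Qed.
Fact saddN : left_inverse (SkewPoly phi 0) sopp sadd.
Proof. by move=> p; apply: val_inj; apply: addNr. Qed.
HB.instance Definition _ :=
  GRing.isZmodule.Build skew saddA saddC sadd0 saddN.

Definition skew_mul (p q : {poly R}) : {poly R} :=
  \poly_(k < size p + size q) \sum_(i < k.+1) p`_i * iter i phi q`_(k - i).

Let iter0 i : iter i phi 0 = 0.
Proof. by elim: i => //= i ->; rewrite rmorph0. Qed.
Let iter_add i : {morph iter i phi : x y / x + y}.
Proof. by elim: i => // i IH x y; rewrite !iterS IH rmorphD. Qed.
Let iterM i : {morph iter i phi : x y / x * y}.
Proof. by elim: i => // i IH x y; rewrite !iterS IH rmorphM. Qed.
Let iter1 i : iter i phi 1 = 1.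
Proof. by elim: i => //= i ->; rewrite rmorph1. Qed.

Lemma coef_skew_mul p q k :
  (skew_mul p q)`_k = \sum_(i < k.+1) p`_i * iter i phi q`_(k - i).
Proof.
rewrite coef_poly; case: ltnP => // le_k; rewrite big1 // => i _.
case: (ltnP i (size p)) => [lt_i|/(nth_default 0)->]; last by rewrite mul0r.
rewrite [q`__]nth_default ?iter0 ?mulr0 // leq_subRL; last by rewrite -ltnS.
by apply: leq_trans le_k; rewrite leq_add2r ltnW.
Qed.

Lemma skew_mulDl : left_distributive skew_mul +%R.
Proof.
move=> p q r; apply/polyP=> k; rewrite coefD !coef_skew_mul -big_split /=.
by apply: eq_bigr => i _; rewrite coefD mulrDl.
Qed.

Lemma skew_mulDr : right_distributive skew_mul +%R.
Proof.
move=> p q r; apply/polyP=> k; rewrite coefD !coef_skew_mul -big_split /=.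
by apply: eq_bigr => i _; rewrite coefD iter_add mulrDr.
Qed.

Lemma skew_mul_mono a b i j :
  skew_mul (a *: 'X^i) (b *: 'X^j) = (a * iter i phi b) *: 'X^(i + j).
Proof.
apply/polyP=> k; rewrite coef_skew_mul coefZ coefXn.
case: (ltnP k i) => [lt_ki|le_ik].
  rewrite big1 ?(ltn_eqF (leq_trans lt_ki (leq_addr _ _))) ?mulr0 // => l _.
  by rewrite coefZ coefXn (ltn_eqF (leq_trans _ lt_ki)) ?mulr0 ?mul0r.
have lt_ik : (i < k.+1)%N by [].
rewrite (bigD1 (Ordinal lt_ik)) //= big1 ?addr0 => [|l ne_l]; last first.
  rewrite coefZ coefXn; case: eqP => [eq_l|]; last by rewrite mulr0 mul0r.
  by case/eqP: ne_l; apply: val_inj.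
rewrite !coefZ !coefXn eqxx mulr1 -(eqn_add2l i) subnKC //.
by case: eqP; rewrite ?mulr1 // !mulr0 iter0 mulr0.
Qed.

Let skew_ind (P : {poly R} -> Prop) :
  P 0 -> (forall p q, P p -> P q -> P (p + q)) ->
  (forall a i, P (a *: 'X^i)) -> forall p, P p.
Proof.
by move=> P0 PD PX p; rewrite -[p]coefK poly_def; apply: (big_ind P).
Qed.

Let skew_mul0 p : skew_mul 0 p = 0.
Proof. by apply: (addrI (skew_mul 0 p)); rewrite -skew_mulDl !addr0. Qed.
Let skew_mulr0 p : skew_mul p 0 = 0.
Proof. by apply: (addrI (skew_mul p 0)); rewrite -skew_mulDr !addr0. Qed.

Lemma skew_mulA : associative skew_mul.
Proof.
move=> p q r; elim/skew_ind: p => [|p1 p2 IH1 IH2|a i].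
- by rewrite !skew_mul0.
- by rewrite !skew_mulDl IH1 IH2.
elim/skew_ind: q => [|p1 p2 IH1 IH2|b j].
- by rewrite !(skew_mul0, skew_mulr0).
- by rewrite !(skew_mulDl, skew_mulDr) IH1 IH2.
elim/skew_ind: r => [|p1 p2 IH1 IH2|c l].
- by rewrite !skew_mulr0.
- by rewrite !skew_mulDr IH1 IH2.
by rewrite !skew_mul_mono iterM mulrA addnA iterD.
Qed.

Lemma skew_mul1 : left_id 1 skew_mul.
Proof.
move=> p; elim/skew_ind: p => [|p1 p2 IH1 IH2|a i]; rewrite ?skew_mulr0 //.
  by rewrite skew_mulDr IH1 IH2.
by rewrite -[1]scale1r -(expr0 'X) skew_mul_mono mul1r.
Qed.

Lemma skew_mulr1 : right_id 1 skew_mul.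
Proof.
move=> p; elim/skew_ind: p => [|p1 p2 IH1 IH2|a i]; rewrite ?skew_mul0 //.
  by rewrite skew_mulDl IH1 IH2.
by rewrite -[1]scale1r -(expr0 'X) skew_mul_mono iter1 mulr1 addn0.
Qed.

Definition smul (p q : skew) : skew :=
  SkewPoly phi (skew_mul (skew_val p) (skew_val q)).

Fact smulA : associative smul.
Proof. by move=> p q r; apply: val_inj; apply: skew_mulA. Qed.
Fact smul1 : left_id (SkewPoly phi 1) smul.
Proof. by move=> p; apply: val_inj; apply: skew_mul1. Qed.
Fact smulr1 : right_id (SkewPoly phi 1) smul.
Proof. by move=> p; apply: val_inj; apply: skew_mulr1. Qed.
Fact smulDl : left_distributive smul +%R.
Proof. by move=> p q r; apply: val_inj; apply: skew_mulDl. Qed.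
Fact smulDr : right_distributive smul +%R.
Proof. by move=> p q r; apply: val_inj; apply: skew_mulDr. Qed.
Fact sone_neq0 : SkewPoly phi 1 != 0.
Proof. by apply/eqP=> /(congr1 val)/eqP; rewrite (oner_eq0 {poly R}). Qed.

HB.instance Definition _ := GRing.Zmodule_isNzRing.Build skew
  smulA smul1 smulr1 smulDl smulDr sone_neq0.

Definition skewC (c : R) : skew := SkewPoly phi c%:P.
Definition skewX : skew := SkewPoly phi 'X.

Lemma skewXC c : skewX * skewC c = skewC (phi c) * skewX.
Proof.
apply: val_inj => /=.
have -> : ('X : {poly R}) = 1 *: 'X^1 by rewrite scale1r expr1.
have E a : a%:P = a *: 'X^0 :> {poly R} by rewrite expr0 alg_polyC.
by rewrite !E !skew_mul_mono mul1r mulr1.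
Qed.

(** The operator  sum_i c_i phi^i  on R defined by a skew polynomial, and the
    action of matrices of skew polynomials on column vectors over R. *)
Definition skew_eval (p : skew) (x : R) : R :=
  \sum_(i < size (skew_val p)) (skew_val p)`_i * iter i phi x.

Definition skew_mxact m n (P : 'M[skew]_(m, n)) (w : 'cV[R]_n) : 'cV[R]_m :=
  \col_i \sum_j skew_eval (P i j) (w j 0).

End SkewPolyRing.

Arguments skewC {R} phi c.

(** {poly F} serves both as A = F_q[theta] and as F_q[t]: the substitution
    theta = t is the identity. A[t] is {poly {poly F}}, whose outer variable is t
    and whose inner variable is theta; for p in A,  p%:P  is p(theta) and
    map_poly polyC p  is p(t). *)

Section Carlitz.
Variable F : finFieldType.
Local Notation q := #|F|.
Local Notation A := {poly F}.
Local Notation k := {fraction {poly F}}.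

Definition carlitzD (i : nat) : A := \prod_(j < i) ('X^(q ^ i) - 'X^(q ^ j)).

(* Gamma_j for j >= 1; the i-th base-q digit of j - 1 vanishes for i >= j. *)
Definition carlitzGamma (j : nat) : A :=
  \prod_(i < j) carlitzD i ^+ ((j.-1 %/ q ^ i) %% q).

Definition in_t (p : A) : {poly {poly F}} := map_poly polyC p.

(* G_m(theta) *)
Definition thakurG (m : nat) : {poly {poly F}} :=
  \prod_(1 <= i < m.+1) ('X^(q ^ m) - ('X^(q ^ i))%:P).

(* The formal power series  1 - sum_i G_i(theta) / D_i(t) x^(q^i)  and
   sum_m H_m / Gamma_(m+1)(t) x^m  over F_q(theta, t), as coefficient sequences. *)
Definition thakur_den (m : nat) : {fraction {poly {poly F}}} :=
  (m == 0)%:R - \sum_(i < m.+1 | (q ^ i == m)%N) (thakurG i)%:F / (in_t (carlitzD i))%:F.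

Definition thakur_gen (H : nat -> {poly {poly F}}) (m : nat) :
    {fraction {poly {poly F}}} :=
  (H m)%:F / (in_t (carlitzGamma m.+1))%:F.

(* The Cauchy product of the two series is 1. *)
Definition anderson_thakur (H : nat -> {poly {poly F}}) : Prop :=
  forall m : nat,
    \sum_(i < m.+1) thakur_den i * thakur_gen H (m - i) = (m == 0)%:R.

Definition is_denominator (x : k) (d : A) : Prop :=
  d \is monic /\ exists2 u : A, coprimep u d & x = u%:F / d%:F.

Definition is_lcm_denominators (S : seq k) (g : A) : Prop :=
  [/\ g \is monic,
      forall x d, x \in S -> is_denominator x d -> d %| g
    & forall g' : A, (forall x d, x \in S -> is_denominator x d -> d %| g') ->
        g %| g'].

(* h_i, ell_i and the polynomial a; the value of hmax is only used when i >= 1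
   and (q - 1) | i, and then q^h - 1 <= i forces h <= i. *)
Definition hmax (i : nat) : nat := \max_(h < i.+1 | (q ^ h - 1 %| i)%N) h.

Definition torsion_poly (p n : nat) : {poly F} :=
  \prod_(1 <= i < n.+1 | (q - 1 %| i)%N)
    ('X^(q ^ hmax i) - 'X) ^+ (p ^ logn p (i %/ (q ^ hmax i - 1)))%N.

End Carlitz.

(* inK is an argument because it forces K to have characteristic p, which makes
   x |-> x^q a ring morphism. *)
Definition frobq (F : finFieldType) (K : fieldType)
  (inK : {rmorphism {fraction {poly F}} -> K}) (x : K) : K := x ^+ #|F|.

Section Frobenius.
Variables (F : finFieldType) (K : closedFieldType).
Variable inK : {rmorphism {fraction {poly F}} -> K}.
Local Notation q := #|F|.

Definition embA (p : {poly F}) : K := inK p%:F.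
Definition embF (c : F) : K := embA c%:P.
Definition theta : K := embA 'X.

(* A[t] -> K[t] and F_q[t] -> K[t] *)
Definition embAt (f : {poly {poly F}}) : {poly K} := map_poly embA f.
Definition embFt (f : {poly F}) : {poly K} := map_poly embF f.

Local Notation frobq := (frobq inK).

Lemma pnat_card_K : [pchar K].-nat q.
Proof.
have [p p_pr pF] := finPcharP F.
have pA : p \in [pchar {poly F}] by exact: (rmorph_pchar (polyC : {rmorphism F -> {poly F}})).
have pk : p \in [pchar {fraction {poly F}}].
  exact: (rmorph_pchar (@FracField.tofrac {poly F} : {rmorphism _ -> _})).
have pK : p \in [pchar K] by exact: (rmorph_pchar inK).
rewrite (eq_pnat _ (pcharf_eq pK)) (card_pprimeChar pF).
by rewrite pnatX pnat_id ?orbT.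
Qed.

Fact frobq_zmod : zmod_morphism frobq.
Proof.
move=> x y; rewrite /frobq exprDn_pchar ?pnat_card_K //.
by rewrite exprNn_pchar ?pnat_card_K.
Qed.
Fact frobq_monoid : monoid_morphism frobq.
Proof. by split=> [|x y]; rewrite /frobq ?expr1n ?exprMn. Qed.
HB.instance Definition _ := GRing.isZmodMorphism.Build K K frobq frobq_zmod.
HB.instance Definition _ := GRing.isMonoidMorphism.Build K K frobq frobq_monoid.

Lemma qroot_exists (x : K) : exists y, frobq y == x.
Proof.
have q_gt0 : (0 < q)%N by apply/card_gt0P; exists 0.
have [|y] := closed_rootP ('X^q - x%:P) _.
  by rewrite size_XnsubC // eqSS -lt0n.
by rewrite /root !hornerE subr_eq0 => ?; exists y.
Qed.

Definition qroot (x : K) : K := xchoose (qroot_exists x).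

Lemma qrootK : cancel qroot frobq.
Proof. by move=> x; apply/eqP/(xchooseP (qroot_exists x)). Qed.
Lemma frobqK : cancel frobq qroot.
Proof. exact: inj_can_sym qrootK (fmorph_inj frobq). Qed.

Fact qroot_zmod : zmod_morphism qroot.
Proof. exact: can2_zmod_morphism frobqK qrootK. Qed.
Fact qroot_monoid : monoid_morphism qroot.
Proof. exact: can2_monoid_morphism frobqK qrootK. Qed.
HB.instance Definition _ := GRing.isZmodMorphism.Build K K qroot qroot_zmod.
HB.instance Definition _ := GRing.isMonoidMorphism.Build K K qroot qroot_monoid.

(* f |-> f^(-1) *)
Definition twist (f : {poly K}) : {poly K} := map_poly qroot f.

HB.instance Definition _ := GRing.RMorphism.copy twist (map_poly qroot).

Definition is_basis (M : lmodType {poly K}) m (b : 'I_m -> M) : Prop :=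
  forall x : M, exists! c : 'rV[{poly K}]_m, x = \sum_i c 0 i *: b i.

(* A left K[t,sigma]-module is a K[t]-module with a semilinear map sigma. *)
Record frob_module := FrobModule {
  fm_car :> lmodType {poly K};
  fm_sigma : fm_car -> fm_car;
  fm_sigmaD : forall x y, fm_sigma (x + y) = fm_sigma x + fm_sigma y;
  fm_sigmaZ : forall (f : {poly K}) x, fm_sigma (f *: x) = twist f *: fm_sigma x;
  fm_free : exists m (b : 'I_m -> fm_car), is_basis b }.

Definition is_frob_hom (M N : frob_module) (g : M -> N) : Prop :=
  [/\ forall x y, g (x + y) = g x + g y,
      forall (f : {poly K}) x, g (f *: x) = f *: g x
    & forall x, g (fm_sigma x) = fm_sigma (g x)].

Record frob_ext (Q M' : frob_module) := FrobExt {
  fe_mid : frob_module;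
  fe_in : M' -> fe_mid;
  fe_out : fe_mid -> Q;
  fe_in_hom : is_frob_hom fe_in;
  fe_out_hom : is_frob_hom fe_out;
  fe_in_inj : injective fe_in;
  fe_out_surj : forall y, exists x, fe_out x = y;
  fe_exact : forall x, fe_out x = 0 <-> exists y, fe_in y = x }.
Arguments fe_in {Q M'} f _.
Arguments fe_out {Q M'} f _.

Definition ext_equiv (Q M' : frob_module) (E1 E2 : frob_ext Q M') : Prop :=
  exists g : fe_mid E1 -> fe_mid E2,
    [/\ is_frob_hom g, bijective g,
        forall x, g (fe_in E1 x) = fe_in E2 x
      & forall x, fe_out E2 (g x) = fe_out E1 x].

Fact unit_free : exists m (b : 'I_m -> {poly K}^o), is_basis b.
Proof.
exists 1%N; exists (fun=> 1) => x; exists (\row_(i < 1) x); split.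
  by rewrite big_ord1 mxE /GRing.scale /= mulr1.
move=> c ->; apply/rowP=> i.
by rewrite mxE big_ord1 /GRing.scale /= mulr1 [i]ord1.
Qed.

Definition frob_unit : frob_module :=
  @FrobModule {poly K}^o twist (rmorphD twist) (rmorphM twist) unit_free.

(** The Frobenius module defined by a matrix Phi: the module of row vectors
    u = sum_i u_i e_i over K[t], with  sigma e_i = sum_j Phi_ij e_j. *)
Section FrobMx.
Variables (m : nat) (Phi : 'M[{poly K}]_m).

Definition mx_sigma (u : 'rV[{poly K}]_m) : 'rV[{poly K}]_m :=
  map_mx twist u *m Phi.

Fact mx_sigmaD u v : mx_sigma (u + v) = mx_sigma u + mx_sigma v.
Proof. by rewrite /mx_sigma map_mxD mulmxDl. Qed.
Fact mx_sigmaZ f u : mx_sigma (f *: u) = twist f *: mx_sigma u.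
Proof. by rewrite /mx_sigma map_mxZ scalemxAl. Qed.
Fact mx_free : exists n (b : 'I_n -> 'rV[{poly K}]_m), is_basis b.
Proof.
exists m; exists (fun i => delta_mx 0 i) => x; exists x.
by split=> [|c ->]; rewrite -row_sum_delta.
Qed.

Definition frob_mx : frob_module := FrobModule mx_sigmaD mx_sigmaZ mx_free.

Lemma frob_mx_sigma i :
  @fm_sigma frob_mx (delta_mx 0 i) = \sum_j Phi i j *: delta_mx 0 j.
Proof.
rewrite /= /mx_sigma map_delta_mx -rowE [LHS]row_sum_delta.
by apply: eq_bigr => j _; rewrite mxE.
Qed.

End FrobMx.

(** The extension  0 -> M' -> M -> 1 -> 0  with M' defined by Phi' and
    M defined by the block matrix  (Phi' 0; v 1). *)
Section ExtRow.
Variables (m : nat) (Phi' : 'M[{poly K}]_m) (v : 'rV[{poly K}]_m).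

Definition ext_mx : 'M[{poly K}]_(m + 1) := block_mx Phi' 0 v 1%:M.

Definition row_in (u : frob_mx Phi') : frob_mx ext_mx := row_mx (u : 'rV_m) 0.
Definition row_out (w : frob_mx ext_mx) : frob_unit :=
  (w : 'rV_(m + 1)) 0 (rshift m 0).

Lemma row_in_hom : is_frob_hom row_in.
Proof.
split=> [x y|f x|x] /=; rewrite /row_in.
- by rewrite add_row_mx addr0.
- by rewrite scale_row_mx scaler0.
by rewrite /mx_sigma map_row_mx map_mx0 mul_row_block !mul0mx !mulmx0 !addr0.
Qed.

Lemma row_out_hom : is_frob_hom row_out.
Proof.
split=> [x y|f x|x] /=; rewrite /row_out ?mxE //.
rewrite big_split_ord /= big1 ?add0r => [|i _].
  by rewrite big_ord1 /ext_mx block_mxEdr !mxE eqxx mulr1.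
by rewrite block_mxEur [X in _ * X]mxE mulr0.
Qed.

Lemma row_in_inj : injective row_in.
Proof. by move=> x y /eq_row_mx[]. Qed.

Lemma row_out_surj y : exists x, row_out x = y.
Proof.
exists (row_mx (0 : 'rV_m) (const_mx y : 'rV_1)).
by rewrite /row_out row_mxEr mxE.
Qed.

Lemma row_exact x : row_out x = 0 <-> exists y, row_in y = x.
Proof.
split=> [x0|[y <-]]; last by rewrite /row_out row_mxEr mxE.
exists (lsubmx (x : 'rV_(m + 1))); rewrite /row_in -[RHS]hsubmxK.
by congr row_mx; apply/rowP=> i; rewrite !mxE ord1 -x0.
Qed.

Definition ext_row : frob_ext frob_unit (frob_mx Phi') :=
  FrobExt row_in_hom row_out_hom row_in_inj row_out_surj row_exact.

End ExtRow.

(** The F_q[t]-module structure of Ext^1(1, M'), on representatives: c in F_q[t]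
    sends the class of the extension with row v to that with row c v, and the
    zero class is that of the row 0. *)
Definition ext_scale m (Phi' : 'M[{poly K}]_m) (c : {poly F})
    (E E' : frob_ext frob_unit (frob_mx Phi')) : Prop :=
  exists v : 'rV[{poly K}]_m,
    ext_equiv E (ext_row Phi' v) /\ ext_equiv E' (ext_row Phi' (embFt c *: v)).

Definition ext_torsion m (Phi' : 'M[{poly K}]_m)
    (E : frob_ext frob_unit (frob_mx Phi')) : Prop :=
  exists2 c : {poly F}, c != 0 & ext_scale c E (ext_row Phi' 0).

Local Notation lin := ('X - theta%:P).
Local Notation twH H m := (twist (embAt (H m))).

Definition PhiM' (H : nat -> {poly {poly F}}) (n : nat) : 'M[{poly K}]_n :=
  \matrix_(i, j)
    if i == 0 :> nat then (if j == 0 :> nat then lin ^+ n else 0)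
    else if j == 0 :> nat then twH H i.-1 * lin ^+ n
    else if j == i then lin ^+ (n - i)
    else 0.

Definition rowC (H : nat -> {poly {poly F}}) (r s : nat)
    (alpha : nat -> {poly F}) (beta0 gamma0 : {poly F}) : 'rV[{poly K}]_(r + s) :=
  let n := (r + s)%N in
  \row_j
    if j == 0 :> nat then
      embFt beta0 * twH H n.-1 * lin ^+ n
      - embFt gamma0 * twH H r.-1 * twH H s.-1 * lin ^+ n
    else embFt (alpha j) * twH H (n - j).-1 * lin ^+ (n - j).

(* nu_1, ..., nu_d *)
Definition nu_seq (n : nat) : seq 'rV[{poly K}]_n :=
  flatten [seq [seq lin ^+ (n - i - l.+1) *: delta_mx 0 i | l <- iota 0 (n - i)]
          | i : 'I_n <- enum 'I_n].

Lemma size_nu_seq n : size (nu_seq n) = (n * n.+1)./2.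
Proof.
have -> : size (nu_seq n) = (\sum_(i < n) (n - i))%N.
  rewrite size_flatten sumnE !big_map -enumT big_enum /=.
  by apply: eq_bigr => i _; rewrite size_map size_iota.
have -> : (\sum_(i < n) (n - i) = \sum_(i < n.+1) val i)%N.
  rewrite big_ord_recl add0n (reindex_inj rev_ord_inj) /=.
  by apply: eq_bigr => i _; rewrite /= subKn.
by rewrite -(big_mkord xpredT id) bin2_sum bin2 mulnC.
Qed.

(** Delta(sum_i u_i nu_i) = (delta(u_1), ..., delta(u_d))^T, where the element
    u_i = sum_j sigma^j c_ij of K[sigma] is given by its right-normal form,
    stored as the polynomial with coefficients c_ij. *)
Definition is_Delta H n (Delta : frob_mx (PhiM' H n) -> 'cV[K]_((n * n.+1)./2)) :
    Prop :=
  let sigma := @fm_sigma (frob_mx (PhiM' H n)) in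
  forall u : 'I_((n * n.+1)./2) -> {poly K},
    Delta (\sum_i \sum_(j < size (u i))
             iter j sigma (((u i)`_j)%:P *: nth 0 (nu_seq n) i))
    = \col_i \sum_(j < size (u i)) (u i)`_j.

Definition is_rho H n (Delta : frob_mx (PhiM' H n) -> 'cV[K]_((n * n.+1)./2))
    (rho : {rmorphism {poly F} -> 'M[skew_poly frobq]_((n * n.+1)./2)}) : Prop :=
  (forall (c : F) (f : {poly F}), rho (c *: f) = skewC frobq (embF c) *: rho f) /\
  (forall x : frob_mx (PhiM' H n),
     Delta ('X *: x) = skew_mxact (rho 'X) (Delta x)).

End Frobenius.

(* Main.v *)
(** The class of the row f is killed by c iff c f = sigma u - u for some row u.
    A top-down recursion on coefficients shows that such a u has coefficients in
    A[t], and each entry satisfies  u_j (t - theta^q)^k = u_j(theta^q)  modulo c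
    (k = n - j; for j = 0 this holds once the other entries are killed).
    Localising at a root lam of c, of exact period d under the q-th power map, a
    solution of this equation modulo (t - lam)^e is killed by (t - lam)^E, with
    E = p^(v_p(k)) if q^d - 1 divides k and E = 0 otherwise: valuations at
    theta = lam give the divisibility, and a polar part that no rational
    function can have gives the bound on E.  The polynomial a contains
    (t - lam) to the power  max_(k < n) E(k) + E(n),  although for a given i its
    factor t^(q^(h_i)) - t need not vanish at all lam with q^d - 1 dividing i
    (for q = 2, i = 21 one has h_i = 3, while 2^2 - 1 divides 21). *)

Require Import Defs.
From HB Require Import structures.
From mathcomp Require Import all_boot all_order all_fingroup all_algebra all_field.
From mathcomp Require Import zify ring.

Set Implicit Arguments.
Unset Strict Implicit.
Unset Printing Implicit Defensive.

Import GRing.Theory.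
Local Open Scope ring_scope.

(** * Congruences modulo a power of t - lam *)

Lemma XnM_val (L : fieldType) (a b : {poly L}) i j :
  a.[0] != 0 -> b.[0] != 0 -> 'X^i * a = 'X^j * b -> i = j.
Proof.
wlog le_ij : a b i j / (i <= j)%N.
  move=> IH a0 b0 E; case: (leqP i j) => [|/ltnW] le; first exact: (IH a b).
  by apply/esym/(IH b a).
move=> a0 _ /eqP; rewrite -(subnK le_ij) addnC exprD -mulrA.
rewrite (inj_eq (mulfI _)) ?expf_neq0 ?polyX_eq0 // => /eqP Ea.
move: a0; rewrite Ea hornerM hornerXn expr0n subn_eq0.
by case: (leqP j i) => [le _|]; [lia | rewrite mul0r eqxx].
Qed.

Lemma Xn_factor (L : idomainType) (a : {poly L}) :
  a != 0 -> exists i b, b.[0] != 0 /\ a = 'X^i * b.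
Proof.
move=> a0; have [i [b]] := multiplicity_XsubC a 0.
rewrite a0 subr0 => b0 E; exists i, b; split; last by rewrite mulrC.
by move: b0; rewrite /root.
Qed.

Lemma horner_comp_Xn0 (L : fieldType) (b : {poly L}) Q : (0 < Q)%N ->
  (b \Po 'X^Q).[0] = b.[0].
Proof. by move=> Q0; rewrite horner_comp hornerXn expr0n (gtn_eqF Q0). Qed.
(** Compare orders at 0: the substitution of ['X^Q] multiplies them by [Q]. *)
Lemma comp_Xn_val (L : fieldType) (Q D : nat) (b u : {poly L}) :
  (0 < Q)%N -> b != 0 -> u.[0] != 0 -> b * ('X^D * u) = b \Po 'X^Q ->
  exists v c, [/\ c.[0] != 0, b = 'X^v * c & (v + D = Q * v)%N].
Proof.
move=> Q0 b0n u0 Eb0; have [v [c [c0 Ec]]] := Xn_factor b0n.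
exists v, c; split=> //; apply: (@XnM_val L (c * u) (c \Po 'X^Q)).
- by rewrite hornerM mulf_neq0.
- by rewrite horner_comp_Xn0.
have -> : 'X^(Q * v) = 'X^v \Po 'X^Q :> {poly L}.
  by rewrite rmorphXn /= comp_polyX exprM.
by rewrite -comp_polyM -Ec -Eb0 Ec exprD; ring.
Qed.

(* With w = b1 / b0, the hypotheses say that w(y) - w(y^Q) has polar part
   c y^-T at 0; then Q divides T and subtracting a multiple of y^-(T/Q) from w
   replaces T by T/Q. *)
Lemma no_polar_part (L : fieldType) (Q D T : nat) (b0 b1 u w : {poly L}) (c : L) :
  (1 < Q)%N -> b0 != 0 -> u.[0] != 0 -> c != 0 -> (0 < T)%N ->
  b0 * ('X^D * u) = b0 \Po 'X^Q ->
  'X^T * (b1 * ('X^D * u) - (b1 \Po 'X^Q))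
    <> b0 * (c%:P * ('X^D * u) + 'X^(D + T) * w).
Proof.
move=> Q1 b0n u0 c0 + Eb0; have [T' leT'] := ubnP T.
elim: T' => // T' IH in T leT' b1 *; move=> T0 E.
have compXn (i : nat) : ('X^i : {poly L}) \Po 'X^Q = 'X^(Q * i).
  by rewrite rmorphXn /= comp_polyX exprM.
have Q0 := ltnW Q1.
have [v [be [be0 Ebe vD]]] := comp_Xn_val Q0 b0n u0 Eb0.
have R0 : (be * (c%:P * u + 'X^T * w)).[0] != 0.
  rewrite !hornerE expr0n (gtn_eqF T0) mul0r addr0.
  by rewrite !mulf_neq0.
have ER : b0 * (c%:P * ('X^D * u) + 'X^(D + T) * w)
    = 'X^(v + D) * (be * (c%:P * u + 'X^T * w)).
  by rewrite Ebe !exprD; ring.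
case: (eqVneq b1 0) => [b10|b1n].
  move: E; rewrite b10 comp_poly0 mul0r subr0 mulr0 ER => /esym/eqP.
  rewrite mulf_eq0 expf_eq0 polyX_eq0 andbF /= => /eqP E.
  by move: R0; rewrite E horner0 eqxx.
have [z [b [bn Eb]]] := Xn_factor b1n.
rewrite ER Eb comp_polyM compXn in E.
(* Without a pole of [b1 / b0] at 0, the left side has order at least [T + v + D], while the right
   side has order [v + D]. *)
case: (leqP v z) => [le_vz|lt_zv].
  have Ez : (z + D = v + D + (z - v))%N by lia.
  have Ez' : (Q * z = v + D + (Q * z - (v + D)))%N.
    by have := leq_mul (leqnn Q) le_vz; lia.
  have : T = 0%N.
    suff : (T + (v + D) <= v + D)%N by lia.
    rewrite leqNgt; apply/negP => ltT.
    move/eqP: E; rewrite [X in X == _](_ : _ = 'X^(v + D) * ('X^T *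
       ('X^(z - v) * (b * u) - 'X^(Q * z - (v + D)) * (b \Po 'X^Q)))); last first.
      rewrite [in LHS]Ez'; rewrite [X in _ * (X - _)](_ : _ = 'X^(z + D) * (b * u));
        last by rewrite exprD; ring.
      by rewrite Ez [X in _ * (X * _ - _)]exprD [X in _ * (_ - X * _)]exprD; ring.
    rewrite (inj_eq (mulfI _)) ?expf_neq0 ?polyX_eq0 // => /eqP E.
    move: R0; rewrite -E hornerM hornerXn expr0n (gtn_eqF T0) mul0r.
    by rewrite eqxx.
  by lia.
(* At a pole, the term in y^Q has the strictly larger pole and alone fixes the order of the left
   side. *)
have ltQ : (Q * z < z + D)%N.
  suff : (Q * z + (v - z) < Q * v)%N by lia.
  rewrite -[X in (_ < _ * X)%N](subnKC (ltnW lt_zv)) mulnDr ltn_add2l.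
  by rewrite ltn_Pmull //; lia.
have ET : (T + Q * z = v + D)%N.
  apply: (@XnM_val L ('X^(z + D - Q * z) * (b * u) - (b \Po 'X^Q)) _ _ _ _ R0).
    rewrite hornerD hornerM hornerXn expr0n subn_eq0 leqNgt ltQ /= mul0r add0r.
    by rewrite hornerN oppr_eq0 horner_comp_Xn0.
  rewrite -E exprD -mulrA; congr (_ * _).
  rewrite mulrBr [_ * (_ * (b * u))]mulrA -exprD subnKC ?(ltnW ltQ) //; congr (_ - _).
  by rewrite exprD; ring.
have ET' : T = (Q * (v - z))%N by rewrite mulnBr; lia.
have T'0 : (0 < v - z)%N by rewrite subn_gt0.
have ltTT : (v - z < T)%N by rewrite ET' ltn_Pmull.
(* Here [b' / b0] is y^-(T/Q), so adding [c b'] to [b1] trades the polar part c y^-T for c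
   y^-(T/Q). *)
set b' := 'X^z * be.
have Eb' : 'X^(v - z) * b' = b0.
  by rewrite Ebe mulrA -exprD subnK // ltnW.
clearbody b'.
have Eb'Q : 'X^T * (b' \Po 'X^Q) = b0 * ('X^D * u).
  by rewrite Eb0 -Eb' comp_polyM compXn ET'.
apply: (IH (v - z)%N _ (b1 + c%:P * b')) => //; first by lia.
have EX : 'X^T = 'X^(T - (v - z)) * 'X^(v - z) :> {poly L}.
  by rewrite -exprD subnK ?(ltnW ltTT).
apply: (@mulfI _ ('X^(T - (v - z)))); first by rewrite expf_neq0 ?polyX_eq0.
rewrite comp_polyD comp_polyM comp_polyC [LHS]mulrA -EX.
have -> : 'X^(T - (v - z)) * (b0 * (c%:P * ('X^D * u) + 'X^(D + (v - z)) * w))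
  = c%:P * ('X^T * b') * ('X^D * u) + 'X^(D + T) * b0 * w :> {poly L}.
  rewrite !exprD EX -Eb'; ring.
have -> : 'X^T * ((b1 + c%:P * b') * ('X^D * u) - ((b1 \Po 'X^Q) + c%:P * (b' \Po 'X^Q)))
  = ('X^T * (b1 * ('X^D * u) - (b1 \Po 'X^Q))) + c%:P * ('X^T * b') * ('X^D * u)
    - c%:P * ('X^T * (b' \Po 'X^Q)) by ring.
rewrite Eb'Q Eb comp_polyM compXn E -ER; ring.
Qed.


(** Write t for the outer variable, x for the inner one and P = p^l. Since W^P = W_0^P + t^P W'^P,
    where W' = (W - W_0) / t, the coefficients of t^0 and t^P can be read off. The first compares
    orders at x = 0 and gives the divisibility. If P < e, the second says that w = Z_P / Z_0
    satisfies w(x) - w(x^Q) = - (W'_0 / W_0)^P. Its polar part is a nonzero multiple of x^-(QP)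
    because p does not divide k, which [no_polar_part] excludes. *)
Lemma polar_obstruction (L : fieldType) p (Q k l e : nat) (Z B U : {poly {poly L}}) :
  p \in [pchar L] -> (1 < Q)%N -> ~~ (p %| k)%N ->
  (U`_0).[0] != 0 -> Z`_0 != 0 -> (0 < e)%N ->
  Z * (U * ('X - ('X^Q)%:P) ^+ k) ^+ (p ^ l)
    = map_poly (comp_poly 'X^Q) Z + 'X^e * B ->
  (Q.-1 %| k * p ^ l)%N /\ (e <= p ^ l)%N.
Proof.
move=> pL Q1 pk U0 Z0 e0; set W := U * _; set P := (p ^ l)%N => E.
have Q0 := ltnW Q1.
have p_pr := pcharf_prime pL.
have P0 : (0 < P)%N by rewrite expn_gt0 prime_gt0.
have k0 : (0 < k)%N by case: (k) pk; rewrite ?dvdn0.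
have pLL : p \in [pchar {poly {poly L}}].
  apply: (rmorph_pchar (polyC : {rmorphism {poly L} -> {poly {poly L}}})).
  exact: (rmorph_pchar (polyC : {rmorphism L -> {poly L}})).
have pL1 : p \in [pchar {poly L}].
  exact: (rmorph_pchar (polyC : {rmorphism L -> {poly L}})).
have nP : [pchar {poly {poly L}}].-nat P.
  by rewrite (eq_pnat _ (pcharf_eq pLL)) pnatX pnat_id ?orbT.
have nP1 : [pchar {poly L}].-nat P.
  by rewrite (eq_pnat _ (pcharf_eq pL1)) pnatX pnat_id ?orbT.
have [W' EW] : exists W', W = W' * 'X + (W`_0)%:P.
  elim/poly_ind: W {E} => [|q c _]; first by exists 0; rewrite coef0 mul0r addr0.
  by exists q; rewrite coefD coefMX coefC add0r.
have coefE j : (Z * W ^+ P)`_j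
    = Z`_j * W`_0 ^+ P + (if (j < P)%N then 0 else (Z * W' ^+ P)`_(j - P)).
  rewrite {1}EW exprDn_pchar // exprMn -polyC_exp mulrDr coefD coefMC addrC.
  by rewrite mulrA coefMXn.
have EW0 : W`_0 = U`_0 * (- 'X^Q) ^+ k.
  by rewrite -!horner_coef0 /W hornerM horner_exp hornerXsubC sub0r.
have EW1 : W'`_0 = U`_1 * (- 'X^Q) ^+ k + U`_0 * (- 'X^Q) ^+ k.-1 *+ k.
  have -> : W'`_0 = W`_1 by rewrite EW coefD coefMX coefC addr0.
  have d1 (q : {poly {poly L}}) : q`_1 = q^`().[0].
    by rewrite horner_coef0 coef_deriv.
  rewrite d1 /W derivM deriv_exp derivXsubC mul1r hornerD !hornerM hornerMn !horner_exp.
  by rewrite hornerXsubC sub0r -d1 horner_coef0 mulrnAr.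
set D := (Q * (k * P))%N.
set u := U`_0 ^+ P * (- 1) ^+ (k * P).
have EV0 : W`_0 ^+ P = 'X^D * u.
  rewrite EW0 exprMn -exprM -[- 'X^Q]mulN1r exprMn -!exprM -/D /u; ring.
have u0 : u.[0] != 0.
  rewrite hornerM !horner_exp mulf_neq0 ?expf_neq0 //=.
  by rewrite !hornerE oppr_eq0 oner_eq0.
have E0 : Z`_0 * ('X^D * u) = Z`_0 \Po 'X^Q.
  move/(congr1 (fun q : {poly {poly L}} => q`_0)): E.
  by rewrite coefE P0 addr0 coefD coef_map coefXnM e0 addr0 EV0.
split.
  have [v [c [_ _ vD]]] := comp_Xn_val Q0 Z0 u0 E0.
  have : (Q.-1 %| Q * (k * P))%N.
    by apply/dvdnP; exists v; rewrite -subn1 mulnBr muln1 -/D [(v * Q)%N]mulnC -vD addKn.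
  by rewrite Gauss_dvdr // -{2}(prednK Q0) coprimenS.
rewrite leqNgt; apply/negP => ltPe.
have EP : Z`_P * ('X^D * u) - (Z`_P \Po 'X^Q) = - (Z`_0 * W'`_0 ^+ P).
  move/(congr1 (fun q : {poly {poly L}} => q`_P)): E.
  rewrite coefE ltnn subnn coefD coef_map coefXnM ltPe addr0 EV0 /= => <-.
  rewrite -horner_coef0 hornerM horner_exp !horner_coef0; ring.
have kL : k%:R != 0 :> L by rewrite -(dvdn_pcharf pL).
(* The quotient W'_0 / W_0 is U_1 / U_0 - k / x^Q; its P-th power supplies both the constant and the
   regular part. *)
apply: (@no_polar_part L Q D (Q * P) Z`_0 Z`_P u
   (- (U`_1 ^+ P * (- 1) ^+ (k * P))) (- ((- 1) ^+ P * k%:R ^+ P))) => //.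
- by rewrite oppr_eq0 mulf_neq0 ?expf_neq0 // oppr_eq0 oner_eq0.
- by rewrite muln_gt0 Q0.
rewrite EP EW1 exprDn_pchar // mulrN mulrCA -mulrN; congr (_ * _).
have -> : 'X^(D + Q * P) = 'X^D * ('X^Q) ^+ P :> {poly L} by rewrite exprD exprM.
have -> : 'X^(Q * P) = ('X^Q) ^+ P :> {poly L} by rewrite exprM.
rewrite -EV0 EW0 -[_ * _ *+ k]mulr_natr ![(_ * _ ^+ k.-1 * _) ^+ P]exprMn [(_ * _ ^+ k.-1) ^+ P]exprMn.
have -> : (- ((-1) ^+ P * k%:R ^+ P))%:P = - ((-1) ^+ P * k%:R ^+ P) :> {poly L}.
  by rewrite polyCN polyCM !polyC_exp polyCN polyC1 polyC_natr.
have -> : (U`_0 * (- 'X^Q) ^+ k) ^+ P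
   = U`_0 ^+ P * ((- 'X^Q) ^+ k.-1) ^+ P * (- 'X^Q) ^+ P.
  by rewrite -{1}(prednK k0) exprS !exprMn; ring.
have -> : (- 'X^Q) ^+ P = (-1) ^+ P * ('X^Q) ^+ P :> {poly L}.
  exact: exprNn.
have -> : (U`_1 * (- 'X^Q) ^+ k) ^+ P = U`_1 ^+ P * (-1) ^+ (k * P) * 'X^D.
  rewrite exprMn [(- 'X^Q) ^+ k]exprNn exprMn -!exprM -/D; ring.
have s2 : ((-1) ^+ P) * ((-1) ^+ P) = 1 :> {poly L}.
  by rewrite -exprMn mulrNN mulr1 expr1n.
transitivity (- ('X^Q ^+ P * (U`_1 ^+ P * (-1) ^+ (k * P) * 'X^D))
  - ((-1) ^+ P * (-1) ^+ P) * k%:R ^+ P * (U`_0 ^+ P * ((- 'X^Q) ^+ k.-1) ^+ P * 'X^Q ^+ P)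
  : {poly L}); last by ring.
by rewrite s2; ring.
Qed.

(** Moves the point t = x = a to the origin; when a^Q = a and Q is a power of the characteristic, it
    commutes with x -> x^Q. *)
Definition shift2 (R : comNzRingType) (a : R) : {poly {poly R}} -> {poly {poly R}} :=
  comp_poly ('X + a%:P%:P) \o map_poly (comp_poly ('X + a%:P)).

HB.instance Definition _ (R : comNzRingType) (a : R) :=
  GRing.RMorphism.copy (shift2 a)
    (comp_poly ('X + a%:P%:P) \o map_poly (comp_poly ('X + a%:P))).

Section Shift.
Variables (R : comNzRingType) (a : R).

Lemma shift2K : cancel (shift2 a) (shift2 (- a)).
Proof.
move=> Z; rewrite /shift2 /= map_comp_poly -comp_polyA.
have -> : map_poly (comp_poly ('X + (- a)%:P)) (map_poly (comp_poly ('X + a%:P)) Z) = Z.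
  apply/polyP=> i; rewrite !coef_map /= -comp_polyA.
  by rewrite comp_polyD comp_polyX comp_polyC polyCN addrNK comp_polyXr.
rewrite rmorphD /= map_polyX map_polyC /= comp_polyC comp_polyD comp_polyX.
by rewrite comp_polyC !polyCN addrNK comp_polyXr.
Qed.

Lemma shift2X : shift2 a 'X = 'X + a%:P%:P.
Proof. by rewrite /shift2 /= map_polyX comp_polyX. Qed.

Lemma shift2C b : shift2 a b%:P = (b \Po ('X + a%:P))%:P.
Proof. by rewrite /shift2 /= map_polyC comp_polyC. Qed.

Lemma shift2_XsubXn m :
  shift2 a ('X - ('X^m)%:P) = 'X + a%:P%:P - (('X + a%:P) ^+ m)%:P.
Proof.
rewrite /shift2 /= rmorphB /= map_polyX map_polyC /= comp_polyB comp_polyX.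
by rewrite comp_polyC rmorphXn /= comp_polyX.
Qed.

Lemma shift2_comp_Xn Q Z : ('X + a%:P) ^+ Q = 'X^Q + a%:P ->
  shift2 a (map_poly (comp_poly 'X^Q) Z) = map_poly (comp_poly 'X^Q) (shift2 a Z).
Proof.
move=> EQ; rewrite /shift2 /= map_comp_poly.
have -> : map_poly (comp_poly 'X^Q) ('X + a%:P%:P) = 'X + a%:P%:P.
  by rewrite rmorphD /= map_polyX map_polyC /= comp_polyC.
congr (_ \Po _); apply/polyP=> i; rewrite !coef_map /= -!comp_polyA.
by rewrite comp_polyD comp_polyC comp_polyX rmorphXn /= comp_polyX EQ.
Qed.

End Shift.

(** Apply x -> x^q, which fixes [T], to the congruence for [j], then use the original congruence to
    put the factor t - x^q in front. *)
Lemma iter_congr (R : comNzRingType) (q n j : nat) (Z T B : {poly {poly R}}) :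
  map_poly (comp_poly 'X^q) T = T ->
  Z * ('X - ('X^q)%:P) ^+ n = map_poly (comp_poly 'X^q) Z + T * B ->
  exists B', Z * (\prod_(i < j) ('X - ('X^(q ^ i.+1))%:P)) ^+ n
             = map_poly (comp_poly 'X^(q ^ j)) Z + T * B'.
Proof.
move=> fT E; elim: j => [|j [B' IH]].
  exists 0; rewrite big_ord0 expr1n mulr1 mulr0 addr0.
  by apply/polyP => i; rewrite coef_map /= expn0 expr1 comp_polyXr.
have := congr1 (map_poly (comp_poly 'X^q)) IH.
rewrite rmorphM rmorphXn rmorph_prod rmorphD /= [map_poly _ (T * _)]rmorphM /= fT.
have -> : map_poly (comp_poly 'X^q) (map_poly (comp_poly 'X^(q ^ j)) Z)
    = map_poly (comp_poly 'X^(q ^ j.+1)) Z.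
  apply/polyP => i; rewrite !coef_map /= -comp_polyA; congr (_ \Po _).
  by rewrite rmorphXn /= comp_polyX -exprM expnS.
rewrite (eq_bigr (fun i : 'I_j => 'X - ('X^(q ^ i.+2))%:P)) => [E'|i _].
  rewrite big_ord_recl /= expn1 exprMn mulrA E mulrDl.
  eexists; rewrite {}E' -addrA -[T * B * _]mulrA -mulrDr; reflexivity.
rewrite rmorphB /= map_polyX map_polyC /= rmorphXn /= comp_polyX -exprM.
by rewrite -expnS.
Qed.

(* [lam] is a value of t of exact period d under the q-th power map; iterating
   the congruence d times isolates the factor t - x^(q^d), the only one
   vanishing at x = t = lam. *)
Lemma local_annihilator (L : fieldType) p q d n e (lam : L) (Z B : {poly {poly L}}) :
  p \in [pchar L] -> [pchar L].-nat q -> (1 < q)%N -> (0 < d)%N -> (0 < n)%N ->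
  lam ^+ (q ^ d) = lam -> (forall i, (0 < i < d)%N -> lam ^+ (q ^ i) != lam) ->
  Z * ('X - ('X^q)%:P) ^+ n
    = map_poly (comp_poly 'X^q) Z + ('X - lam%:P%:P) ^+ e * B ->
  exists B', ('X - lam%:P%:P) ^+ ((q ^ d - 1 %| n) * p ^ logn p n) * Z
             = ('X - lam%:P%:P) ^+ e * B'.
Proof.
case: d => // d pL qL q1 _ n0 lamd lami E.
set Q := (q ^ d.+1)%N in lamd *.
have Q1 : (1 < Q)%N by rewrite -(exp1n d.+1) ltn_exp2r.
have pL1 : p \in [pchar {poly L}].
  exact: (rmorph_pchar (polyC : {rmorphism L -> {poly L}})).
have QL : [pchar {poly L}].-nat Q.
  rewrite pnatX; apply/orP; left; move: qL.
  by rewrite (eq_pnat _ (pcharf_eq pL)) (eq_pnat _ (pcharf_eq pL1)).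
have shQ : ('X + lam%:P) ^+ Q = 'X^Q + lam%:P :> {poly L}.
  by rewrite exprDn_pchar // -polyC_exp lamd.
have fT : map_poly (comp_poly 'X^q) (('X - lam%:P%:P) ^+ e) = ('X - lam%:P%:P) ^+ e.
  by rewrite rmorphXn rmorphB /= map_polyX map_polyC /= comp_polyC.
have [B1 E1] := iter_congr d.+1 fT E.
have shT m : shift2 lam (('X - lam%:P%:P) ^+ m) = 'X^m.
  by rewrite rmorphXn rmorphB /= shift2X shift2C comp_polyC addrK.
have unT m : shift2 (- lam) ('X^m) = ('X - lam%:P%:P) ^+ m.
  by rewrite rmorphXn /= shift2X !polyCN.
suff [B' EB] : exists B', 'X^((q ^ d.+1 - 1 %| n) * p ^ logn p n) * shift2 lam Z
                          = 'X^e * B'.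
  exists (shift2 (- lam) B').
  by rewrite -!unT -{1}[Z](shift2K lam) -!rmorphM EB.
case: (eqVneq (shift2 lam Z) 0) => [->|nzZ]; first by exists 0; rewrite !mulr0.
have [kap [Z0 [Z00 EZ]]] := Xn_factor nzZ.
case: (leqP e kap) => [le_e|lt_e].
  exists ('X^((q ^ d.+1 - 1 %| n) * p ^ logn p n) * ('X^(kap - e) * Z0)).
  by rewrite EZ -[in LHS](subnKC le_e) exprD; ring.
set l := logn p n; have p_pr := pcharf_prime pL.
have [k pk En] := pfactor_coprime p_pr n0.
have npk : ~~ (p %| k)%N by rewrite -prime_coprime.
(* The factors t - x^(q^i) with 0 < i <= [d] do not vanish at the origin after translation, because
   the exact period is [d.+1]. *)
set U := \prod_(i < d) ('X + lam%:P%:P - (('X + lam%:P) ^+ (q ^ i.+1))%:P)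
   : {poly {poly L}}.
have E2 : Z0 * (U ^+ k * ('X - ('X^Q)%:P) ^+ k) ^+ (p ^ l)
    = map_poly (comp_poly 'X^Q) Z0 + 'X^(e - kap) * shift2 lam B1.
  apply: (@mulfI _ 'X^kap); first by rewrite expf_neq0 ?polyX_eq0.
  rewrite mulrA -EZ mulrDr mulrA -exprD (subnKC (ltnW lt_e)) -(shT e) -[_ * shift2 _ _]rmorphM.
  have -> : 'X^kap * map_poly (comp_poly 'X^Q) Z0 = shift2 lam (map_poly (comp_poly 'X^Q) Z).
    by rewrite shift2_comp_Xn // EZ rmorphM rmorphXn /= map_polyX.
  rewrite -rmorphD -E1 rmorphM [X in _ = _ * X]rmorphXn /= -exprMn -exprM -En; congr (_ * _ ^+ n).
  rewrite rmorph_prod big_ord_recr /=; congr (_ * _); last first.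
    rewrite shift2_XsubXn -/Q shQ polyCD.
    by rewrite opprD addrACA subrr addr0.
  apply: eq_bigr => i _.
  by rewrite shift2_XsubXn.
have U0 : ((U ^+ k)`_0).[0] != 0.
  rewrite -horner_coef0 horner_exp horner_exp expf_neq0 // /U horner_prod horner_prod.
  apply/prodf_neq0 => i _.
  rewrite !(hornerE, hornerXn) subr_eq0 eq_sym lami //.
  exact: ltn_ord.
have e0 : (0 < e - kap)%N by rewrite subn_gt0.
rewrite horner_coef0 in Z00.
(* So [q ^ d.+1 - 1] divides [n] whenever something is left to kill, and t^(p^l) then raises the
   order [kap] in t to at least [e]. *)
have [Qn le_P] := polar_obstruction pL Q1 npk U0 Z00 e0 E2.
rewrite -En -/Q -/l subn1 in Qn *; rewrite Qn mul1n.
exists ('X^(p ^ l + kap - e) * Z0); rewrite EZ !mulrA -!exprD.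
by congr ('X^_ * _); rewrite subnKC // addnC -leq_subLR.
Qed.

(** * The order of the polynomial a at a root *)

Section TorsionPoly.
Variables (F : finFieldType) (p : nat).
Hypothesis pF : p \in [pchar F].
Local Notation q := #|F|.

Let p_pr : prime p := pcharf_prime pF.

Lemma card_gt1 : (1 < q)%N.
Proof. exact: finNzRing_gt1. Qed.

Lemma card_pexp : exists2 a, (0 < a)%N & q = (p ^ a)%N.
Proof.
exists (logn p q); last exact: card_pprimeChar.
by case: (logn p q) (card_pprimeChar pF) card_gt1 => // ->.
Qed.

Lemma coprime_card_pred h : (0 < h)%N -> coprime p (q ^ h - 1).
Proof.
have [a a0 ->] := card_pexp; rewrite -expnM => h0.
have ah0 : (0 < a * h)%N by rewrite muln_gt0 a0.
rewrite prime_coprime // -(prednK ah0) expnS.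
apply/negP=> /(dvdn_sub (dvdn_mulr (p ^ (a * h).-1) (dvdnn p))).
rewrite subKn ?muln_gt0 ?expn_gt0 ?prime_gt0 //.
by rewrite dvdn1 => /eqP p1; move: p_pr; rewrite p1.
Qed.

Lemma ltn_card_exp h : (h < q ^ h)%N.
Proof. exact: ltn_expl card_gt1. Qed.

Lemma leq_card_pred h k : (q ^ h - 1 <= q ^ k - 1)%N -> (h <= k)%N.
Proof.
move=> le; rewrite -(leq_exp2l _ _ card_gt1).
have := ltn_card_exp k; have := ltn_card_exp h; lia.
Qed.

Lemma leq_hmax h i : (0 < i)%N -> (q ^ h - 1 %| i)%N -> (h <= hmax F i)%N.
Proof.
move=> i0 dv; have lt_h : (h < i.+1)%N.
  have := dvdn_leq i0 dv; have := ltn_card_exp h; lia.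
exact: (@leq_bigmax_cond _ _ (fun j : 'I_i.+1 => val j) (Ordinal lt_h)).
Qed.

Lemma hmax_dvdn i : (q - 1 %| i)%N -> (q ^ hmax F i - 1 %| i)%N.
Proof.
move=> dv; case: (posnP i) => [->//|i0].
have lt1 : (1 < i.+1)%N by [].
have A0 : (0 < #|[pred h : 'I_i.+1 | (q ^ h - 1 %| i)%N]|)%N.
  by apply/card_gt0P; exists (Ordinal lt1); rewrite inE /= expn1.
by have [h] := eq_bigmax_cond (fun j : 'I_i.+1 => val j) A0; rewrite inE /hmax => ? ->.
Qed.

Lemma hmax_gt0 i : (0 < i)%N -> (q - 1 %| i)%N -> (0 < hmax F i)%N.
Proof. by move=> i0 dv; apply: leq_hmax; rewrite ?expn1. Qed.

(** For the maximal h, [q ^ h - 1] is prime to [p], so it already divides [q ^ d - 1], which forces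
    [h <= d]. *)
Lemma hmax_card_pred d e : (0 < d)%N -> hmax F ((q ^ d - 1) * p ^ e) = d.
Proof.
move=> d0; have w0 : (0 < q ^ d - 1)%N.
  by rewrite subn_gt0 -(exp1n d) ltn_exp2r ?card_gt1.
have i0 : (0 < (q ^ d - 1) * p ^ e)%N by rewrite muln_gt0 w0 expn_gt0 prime_gt0.
have dv : (q - 1 %| (q ^ d - 1) * p ^ e)%N.
  by apply/dvdn_mulr; rewrite -[X in (_ %| _ - X)%N](exp1n d) subn_exp dvdn_mulr.
apply/eqP; rewrite eqn_leq leq_hmax ?dvdn_mulr // andbT.
apply: leq_card_pred; apply: dvdn_leq => //.
rewrite -(@Gauss_dvdl _ _ (p ^ e)) ?hmax_dvdn //.
by rewrite coprime_sym coprimeXl // coprime_card_pred // hmax_gt0.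
Qed.

Lemma logn_hmax i : (0 < i)%N -> (q - 1 %| i)%N ->
  logn p (i %/ (q ^ hmax F i - 1)) = logn p i.
Proof.
move=> i0 dv; rewrite logn_div ?hmax_dvdn // -[X in (_ - X)%N]/(logn p _).
by rewrite [X in (_ - X)%N]logn_coprime ?subn0 // coprime_card_pred // hmax_gt0.
Qed.

Lemma torsion_poly_neq0 n : torsion_poly F p n != 0.
Proof.
rewrite /torsion_poly big_seq_cond prodf_seq_neq0; apply/allP => i _ /=.
apply/implyP => /andP[]; rewrite mem_index_iota => /andP[i0 _] dv.
rewrite expf_neq0 // -size_poly_gt0 size_polyDl ?size_polyXn //.
rewrite size_polyN size_polyX ltnS (leq_trans card_gt1) //.
by rewrite -{1}(expn1 q) leq_exp2l ?card_gt1 // hmax_gt0.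
Qed.

Section AtRoot.
Variables (L : fieldType) (iota : {rmorphism F -> L}) (lam : L) (d n : nat).
Hypotheses (d0 : (0 < d)%N) (n0 : (0 < n)%N) (lamd : lam ^+ (q ^ d) = lam).

Local Notation T := ('X - lam%:P).
Local Notation w := (q ^ d - 1)%N.

Let P i := [&& (0 < i)%N, (i <= n)%N & (q - 1 %| i)%N].
(** Such an [i] indexes a factor of the product that vanishes at [lam] to order at least
    [p ^ logn p i]. *)
Let good i := P i && (lam ^+ (q ^ hmax F i) == lam).
Let fac i : {poly L} :=
  if (q - 1 %| i)%N then
    ('X^(q ^ hmax F i) - 'X) ^+ (p ^ logn p (i %/ (q ^ hmax F i - 1)))%N
  else 1.

Let tpE : map_poly iota (torsion_poly F p n) = \prod_(1 <= i < n.+1) fac i.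
Proof.
rewrite rmorph_prod /= big_mkcond; apply: eq_bigr => i _ /=; rewrite /fac.
case: ifP => // _.
by rewrite rmorphXn rmorphB /= map_polyXn map_polyX.
Qed.

Let fac_good i : good i -> T ^+ (p ^ logn p i) %| fac i.
Proof.
case/andP=> /and3P[i0 _ dv] /eqP lamE; rewrite /fac dv logn_hmax //.
by apply: dvdp_exp2r; rewrite dvdp_XsubCl /root !hornerE lamE subrr.
Qed.

Let good1 i : good i -> T ^+ (p ^ logn p i) %| map_poly iota (torsion_poly F p n).
Proof.
move=> gi; have /and3P[i0 ile _] := proj1 (andP gi).
rewrite tpE (big_rem i) ?mem_index_iota ?i0 //=.
by apply: dvdp_trans (fac_good gi) _; apply: dvdp_mulr.
Qed.

Let good2 i j : good i -> good j -> i != j ->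
  T ^+ (p ^ logn p i + p ^ logn p j) %| map_poly iota (torsion_poly F p n).
Proof.
move=> gi gj ij; have /and3P[i0 ile _] := proj1 (andP gi).
have /and3P[j0 jle _] := proj1 (andP gj).
rewrite tpE (big_rem i) ?mem_index_iota ?i0 //= (big_rem j) /=.
  by rewrite mulrA exprD dvdp_mulr // dvdp_mul ?fac_good.
by rewrite mem_rem_uniq ?iota_uniq // inE eq_sym ij mem_index_iota j0.
Qed.

(* The rational torsion of the sub C^{(x)n} and that of the quotient, a direct
   sum of the C^{(x)k} with k < n, contribute the two summands; the second is a
   maximum because the quotient is a direct sum. *)
Lemma torsion_poly_order :
  T ^+ (\max_(k < n | (0 < k)%N && (w %| k)%N) p ^ logn p k
        + (w %| n)%N * p ^ logn p n) %| map_poly iota (torsion_poly F p n).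
Proof.
set M := \max_(k < n | _) _.
have w0 : (0 < w)%N by rewrite subn_gt0 -(exp1n d) ltn_exp2r ?card_gt1.
have cpw e : coprime w (p ^ e).
  by rewrite coprime_sym coprimeXl // coprime_card_pred.
have dvw : (q - 1 %| w)%N.
  by rewrite -[X in (_ %| _ - X)%N](exp1n d) subn_exp dvdn_mulr.
have logw e : logn p (w * p ^ e) = e.
  by rewrite logn_Gauss ?pfactorK // coprime_card_pred.
(* The product of [w] and a power of [p] has [hmax] exactly [d], so its factor vanishes at [lam];
   for other multiples of [w] this may fail. *)
have goodw e : (w * p ^ e <= n)%N -> good (w * p ^ e).
  move=> le; rewrite /good /P muln_gt0 w0 expn_gt0 prime_gt0 // le dvdn_mulr //=.
  by rewrite hmax_card_pred // lamd.
have dvd_wp k : (w %| k)%N -> (w * p ^ logn p k %| k)%N.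
  by move=> wk; rewrite Gauss_dvd // wk pfactor_dvdnn.
have leM k : (0 < k < n)%N -> (w %| k)%N -> (p ^ logn p k <= M)%N.
  case/andP=> k0 kn wk.
  apply: (@leq_bigmax_cond _ _ (fun j : 'I_n => p ^ logn p j)%N (Ordinal kn)).
  by rewrite /= k0.
have [M0|[k0 ltk0 [wk0 EM]]] : M = 0%N \/
    exists2 k, (0 < k < n)%N & (w %| k)%N /\ M = (p ^ logn p k)%N.
  case: (posnP #|[pred k : 'I_n | (0 < k)%N && (w %| k)%N]|) => [c0|c0].
    by left; rewrite /M big_pred0 // => k; have := card0_eq c0 k.
  right; have [k] := eq_bigmax_cond (fun j : 'I_n => p ^ logn p j)%N c0.
  by rewrite inE => /andP[k0 wk] E; exists k; rewrite ?k0 ?ltn_ord.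
- case: (boolP (w %| n)%N) => [wn|_]; last by rewrite M0 expr0 dvd1p.
  (* If [w < n], then [w] itself would make the maximum positive. *)
  have En : n = (w * p ^ 0)%N.
    rewrite expn0 muln1; apply/eqP; rewrite eqn_leq (dvdn_leq n0 wn) andbT leqNgt.
    apply/negP => ltw; have := leM w; rewrite w0 ltw dvdnn M0 => /(_ isT isT).
    by rewrite leqNgt expn_gt0 prime_gt0.
  rewrite M0 add0n mul1n; apply: good1; rewrite En; apply: goodw.
  by rewrite -En.
(* The index [k0] attaining the maximum is replaced by its divisor [w * p ^ e], which is good and
   has the same p-adic valuation. *)
set e := logn p k0 in EM.
have lt1 : (w * p ^ e < n)%N.
  by case/andP: ltk0 => k00; apply: leq_ltn_trans; rewrite dvdn_leq ?dvd_wp.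
have g1 := goodw e (ltnW lt1).
case: (boolP (w %| n)%N) => [wn|_]; last first.
  by rewrite EM mul0n addn0 -{1}(logw e) good1.
rewrite EM mul1n -{1}(logw e).
have dvn := dvd_wp n wn; set f := logn p n in dvn *.
have len : (w * p ^ f <= n)%N by rewrite dvdn_leq.
(* If h_n does not give a factor vanishing at lam, w p^(v_p n) is a second
   index besides w p^e which does. *)
case: (boolP (good n)) => [gn|bad]; first by apply: good2; rewrite ?ltn_eqF.
have g2 := goodw f len.
rewrite -{1}(logw f); apply: good2 => //; apply/negP => /eqP Eef.
(* If the two indices coincide, then [n] is good after all: it will follow that [hmax F n = d]. *)
have {}Eef : e = f by rewrite -(logw e) Eef logw.
case/negP: bad; rewrite /good /P n0 leqnn (dvdn_trans dvw) //=.
suff -> : hmax F n = d by rewrite lamd.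
have hn := hmax_dvdn (dvdn_trans dvw wn).
apply/eqP; rewrite eqn_leq leq_hmax // andbT.
have [j En] := dvdnP dvn.
have pj : ~~ (p %| j)%N.
  apply/negP => /dvdnP[j' Ej].
  have : (p ^ f.+1 %| n)%N.
    by apply/dvdnP; exists (j' * w)%N; rewrite En Ej expnS; nia.
  by rewrite pfactor_dvdn // ltnn.
(* If [p <= j], the index [w * p ^ f.+1] lies below [n] and contributes more than the maximum
   [p ^ f]. *)
have ltjp : (j < p)%N.
  rewrite ltnNge; apply/negP => lepj.
  have lt2 : (w * p ^ f.+1 < n)%N.
    rewrite En expnS ltn_neqAle; apply/andP; split.
      rewrite mulnCA eqn_pmul2r ?muln_gt0 ?w0 ?expn_gt0 ?prime_gt0 //.
      by apply/negP => /eqP Epj; rewrite -Epj dvdnn in pj.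
    by rewrite mulnCA leq_mul2r lepj orbT.
  have := leM (w * p ^ f.+1)%N.
  rewrite lt2 muln_gt0 w0 expn_gt0 prime_gt0 // dvdn_mulr // logw EM Eef.
  move=> /(_ isT isT).
  by rewrite leq_exp2l ?prime_gt1 // ltnn.
(* For h = [hmax F n], [q ^ h - 1] is prime to [p], hence divides [j * w]. As j <= q - 1, it is at
   most (q - 1)(q^d - 1), so q^h < q^(d+1). *)
have hj : (q ^ hmax F n - 1 %| j * w)%N.
  rewrite -(@Gauss_dvdl _ _ (p ^ f)); first by rewrite -mulnA -En.
  rewrite coprime_sym coprimeXl // coprime_card_pred // hmax_gt0 //.
  exact: dvdn_trans dvw wn.
have j0 : (0 < j)%N by case: (j) En n0 => // ->.
have pq : (p <= q)%N.
  have [a a0 ->] := card_pexp.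
  by rewrite -{1}(expn1 p) leq_exp2l ?prime_gt1.
have le3 : (q ^ hmax F n - 1 <= j * w)%N by rewrite dvdn_leq ?muln_gt0 ?j0.
rewrite -ltnS -(ltn_exp2l _ _ card_gt1) expnS.
have q0 : (0 < q ^ d)%N by rewrite expn_gt0 ltnW ?card_gt1.
have leq1 : (j <= q.-1)%N by rewrite -ltnS (ltn_predK card_gt1) (leq_trans ltjp).
have le4 : (j * w <= q.-1 * w)%N by rewrite leq_mul2r leq1 orbT.
have le5 : (q.-1 * w + q.-1 = q.-1 * q ^ d)%N.
  by rewrite mulnBr muln1 subnK // leq_pmulr.
have q2 : (0 < q.-1)%N by rewrite -subn1 subn_gt0 card_gt1.
have -> : (q * q ^ d = q ^ d + q.-1 * q ^ d)%N.
  by rewrite -mulSn (ltn_predK card_gt1).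
move: (leq_trans le3 le4) le5 q2 q0; clear.
set m := (_ * w)%N; set m' := (_ * q ^ d)%N; set x := (q ^ d)%N.
set y := (q ^ _)%N; lia.
Qed.

End AtRoot.
End TorsionPoly.

(** * Local tests for divisibility, and periods of roots *)

(** Strip a common root from [c] and [r] and recurse. At that root the exponents drop by one; at
    another root the powers are coprime to the stripped factor. *)
Lemma dvdp_locally (L : closedFieldType) (c r : {poly L}) : c != 0 ->
  (forall lam e, ('X - lam%:P) ^+ e %| c -> ('X - lam%:P) ^+ e %| r) -> c %| r.
Proof.
have [m] := ubnP (size c); elim: m => // m IH in c r * => szc c0 loc.
have [c1|nc1] := eqVneq (size c) 1%N.
  by rewrite (eqp_dvdl _ (_ : c %= 1)) ?dvd1p // -size_poly_eq1 c1.
have /closed_rootP[lam rc] := nc1.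
have Tc : 'X - lam%:P %| c by rewrite dvdp_XsubCl.
have /dvdpP[r' Er] : 'X - lam%:P %| r by have := loc lam 1%N; rewrite expr1; apply.
have /dvdpP[c' Ec] := Tc.
have c'0 : c' != 0 by apply: contraNneq c0 => c'0; rewrite Ec c'0 mul0r.
rewrite Ec Er dvdp_mul2r ?polyXsubC_eq0 //; apply: IH => // [|mu e Tmu].
  by move: szc; rewrite Ec size_mul ?polyXsubC_eq0 // size_XsubC addn2.
have [Emu|ne] := eqVneq mu lam.
  rewrite {}Emu in Tmu *.
  rewrite -(@dvdp_mul2r _ ('X - lam%:P)) ?polyXsubC_eq0 // -exprSr -Er.
  by apply: loc; rewrite Ec exprSr dvdp_mul2r ?polyXsubC_eq0.
have cop : coprimep (('X - mu%:P) ^+ e) ('X - lam%:P).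
  by rewrite coprimep_expl // coprimep_XsubC2 // subr_eq0 eq_sym.
rewrite -(Gauss_dvdpl _ cop) -Er; apply: loc.
by rewrite Ec dvdp_mulr.
Qed.

(** Exchanging the two variables makes c(t) a constant, so divisibility is tested on each
    coefficient in theta. It may be tested over [L], since divisibility of polynomials over [F] is
    unchanged by field extension. *)
Lemma in_t_dvd_locally (F : fieldType) (L : closedFieldType)
    (iota : {rmorphism F -> L}) (c a : {poly F}) (Z : {poly {poly F}}) :
  c != 0 ->
  (forall lam e, ('X - lam%:P) ^+ e %| map_poly iota c ->
     exists B, map_poly polyC (map_poly iota a) * map_poly (map_poly iota) Z
               = ('X - lam%:P%:P) ^+ e * B) ->
  exists Z', map_poly polyC a * Z = map_poly polyC c * Z'.
Proof.
move=> c0 loc; set N := swapXY Z.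
have dv i : c %| a * N`_i.
  rewrite -(dvdp_map iota) rmorphM /=; apply: dvdp_locally => [|lam e Tc].
    by rewrite map_poly_eq0.
  have [B /(congr1 swapXY)] := loc _ _ Tc.
  have -> : 'X - (lam%:P)%:P = map_poly polyC ('X - lam%:P) :> {poly {poly L}}.
    by rewrite rmorphB /= map_polyX map_polyC.
  rewrite -rmorphXn !rmorphM /= !swapXY_map_polyC swapXY_map -/N.
  move/(congr1 (fun P : {poly {poly L}} => P`_i)).
  by rewrite !coefCM coef_map /= => ->; rewrite dvdp_mulr.
exists (swapXY (\poly_(i < size N) ((a * N`_i) %/ c))).
apply: (can_inj swapXYK); rewrite !rmorphM /= !swapXY_map_polyC swapXYK -/N.
apply/polyP => i; rewrite !coefCM coef_poly; case: ltnP => [_|le].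
  by rewrite [RHS]mulrC divpK ?dv.
by rewrite nth_default ?mulr0.
Qed.

Section Period.
Variables (F : finFieldType) (L : fieldType) (iota : {rmorphism F -> L}).
Local Notation q := #|F|.

Lemma pnat_card_rmorph : [pchar L].-nat q.
Proof.
have [p p_pr pF] := finPcharP F.
rewrite (eq_pnat _ (pcharf_eq (rmorph_pchar iota pF))) (card_pprimeChar pF).
by rewrite pnatX pnat_id ?orbT.
Qed.

Lemma horner_map_card (c : {poly F}) x :
  (map_poly iota c).[x ^+ q] = (map_poly iota c).[x] ^+ q.
Proof.
elim/poly_ind: c => [|c b IH].
  by rewrite rmorph0 !horner0 expr0n gtn_eqF // ltnW ?card_gt1.
rewrite rmorphD rmorphM /= map_polyX map_polyC !hornerE IH.
rewrite exprDn_pchar ?pnat_card_rmorph // exprMn.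
by rewrite /= -[in RHS]rmorphXn /= expf_card.
Qed.

(** The q-th power map preserves the finite set of roots, so two iterates of [lam] coincide; its
    injectivity moves the coincidence back to [lam]. *)
Lemma root_period (c : {poly F}) lam :
  c != 0 -> root (map_poly iota c) lam ->
  exists d, [/\ (0 < d)%N, lam ^+ (q ^ d) = lam
             & forall i, (0 < i < d)%N -> lam ^+ (q ^ i) != lam].
Proof.
move=> c0 rc; pose x i := lam ^+ (q ^ i).
have rx i : root (map_poly iota c) (x i).
  elim: i => [|i IH]; first by rewrite /x expn0 expr1.
  rewrite /x expnSr exprM /root horner_map_card expf_eq0.
  by move: IH; rewrite /root => /eqP ->; rewrite eqxx ltnW ?card_gt1.
have frob_inj i : injective (fun y : L => y ^+ (q ^ i)).
  have nq : [pchar L].-nat (q ^ i)%N by rewrite pnatX pnat_card_rmorph.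
  move=> y z /eqP; rewrite -subr_eq0 -exprNn_pchar // -exprDn_pchar //.
  by rewrite expf_eq0 subr_eq0 => /andP[_ /eqP].
have ex_d : exists d, (0 < d)%N && (x d == lam).
  set s := map_poly iota c in rx rc *; have s0 : s != 0 by rewrite map_poly_eq0.
  have nu : ~~ uniq [seq x i | i <- seq.iota 0 (size s)].
    apply/negP => us; have := max_poly_roots s0 _ us.
    rewrite size_map size_iota ltnn => H; have: false; last by [].
    by apply: H; apply/allP => _ /mapP[i _ ->].
  have [i [j [ij Exy]]] : exists i j, (i < j)%N /\ x i = x j.
    have [inj|] := boolP [forall i : 'I_(size s), forall j : 'I_(size s),
                          (x i == x j) ==> (i == j)].
      case/negP: nu; rewrite map_inj_in_uniq ?iota_uniq // => i j.
      rewrite !mem_iota !add0n /= => li lj Exy.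
      move/forallP: inj => /(_ (Ordinal li)) /forallP /(_ (Ordinal lj)).
      by rewrite /= Exy eqxx /= => /eqP[].
    rewrite negb_forall => /existsP[i]; rewrite negb_forall => /existsP[j].
    rewrite negb_imply => /andP[/eqP Exy ne].
    case: (ltngtP i j) => [lt|lt|eq]; [by exists i, j|by exists j, i|].
    by case/eqP: ne; apply: val_inj.
  exists (j - i)%N; rewrite subn_gt0 ij; apply/eqP/(frob_inj i).
  by rewrite /x -exprM -expnD subnK ?(ltnW ij) // -/(x j) -Exy.
exists (ex_minn ex_d); case: ex_minnP => d /andP[d0 /eqP Ed] min; split=> // i.
case/andP=> i0 lt; apply/negP => Ei; have := min i.
by rewrite i0 /x Ei leqNgt lt => /(_ isT).
Qed.

End Period.

(** * Torsion of rational classes *)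

Section RationalTorsion.
Variables (F : finFieldType) (p : nat) (L : closedFieldType).
Variables (iota : {rmorphism F -> L}).
Hypothesis pF : p \in [pchar F].
Local Notation q := #|F|.
Local Notation Frob := (map_poly (comp_poly 'X^q)).
Local Notation lin1 := ('X - ('X^q)%:P).

(** These are the untwisted coordinates of c f = sigma u - u. The system is triangular: at a root of
    [c], the entries off 0 are killed by one common power, a maximum over the exponents [n - i];
    after that, entry 0 obeys a congruence of the same kind with exponent [n]. [torsion_poly_order]
    accounts for both powers. *)
Lemma rational_torsion n (c : {poly F}) (h G mu : 'I_n -> {poly {poly F}}) :
  c != 0 ->
  (forall i : 'I_n, i != 0 :> nat ->
     mu i * lin1 ^+ (n - i) = Frob (mu i) + in_t c * G i) ->
  (forall i : 'I_n, i = 0 :> nat ->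
     (mu i + \sum_(j < n | j != 0 :> nat) mu j * h j) * lin1 ^+ n
     = Frob (mu i) + in_t c * G i) ->
  forall i, exists mu', in_t (torsion_poly F p n) * mu i = in_t c * mu'.
Proof.
move=> c0 Epos E0 i; have n0 : (0 < n)%N by apply: leq_ltn_trans (ltn_ord i).
have pL : p \in [pchar L] := rmorph_pchar iota pF.
have qL := pnat_card_rmorph iota.
apply: (in_t_dvd_locally (iota := iota)) => // lam e Tc.
case: (posnP e) => [->|e0]; first by eexists; rewrite expr0 mul1r; reflexivity.
have rc : root (map_poly iota c) lam.
  by rewrite -dvdp_XsubCl (dvdp_trans _ Tc) // -(prednK e0) exprS dvdp_mulr.
have [d [d0 lamd lami]] := root_period c0 rc.
pose T : {poly {poly L}} := 'X - lam%:P%:P.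
have upT (s : {poly L}) m : ('X - lam%:P) ^+ m %| s -> exists s', map_poly polyC s = T ^+ m * s'.
  case/dvdpP => s' ->; exists (map_poly polyC s').
  by rewrite rmorphM rmorphXn rmorphB /= map_polyX map_polyC mulrC.
have [c' Ec'] := upT _ _ Tc.
set M := \max_(k < n | (0 < k)%N && (q ^ d - 1 %| k)%N) p ^ logn p k.
have [a' Ea'] := upT _ _ (torsion_poly_order pF iota d0 n0 lamd).
rewrite -/M in Ea'.
pose up : {poly {poly F}} -> {poly {poly L}} := map_poly (map_poly iota).
have upM x y : up (x * y) = up x * up y by rewrite /up rmorphM.
have upD x y : up (x + y) = up x + up y by rewrite /up rmorphD.
have up_lin m : up (lin1 ^+ m) = lin1 ^+ m.
  by rewrite /up rmorphXn rmorphB /= map_polyX map_polyC /= map_polyXn.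
have up_Frob x : up (Frob x) = Frob (up x).
  apply/polyP => j; rewrite /up !coef_map /= map_comp_poly.
  by rewrite rmorphXn /= map_polyX.
have up_c : up (in_t c) = T ^+ e * c'.
  rewrite -Ec' /up /in_t; apply/polyP => j.
  by rewrite !coef_map /= map_polyC.
have FrobT m : Frob (T ^+ m) = T ^+ m.
  by rewrite rmorphXn rmorphB /= map_polyX map_polyC /= comp_polyC.
have kill_pos (j : 'I_n) : j != 0 :> nat -> exists B, T ^+ M * up (mu j) = T ^+ e * B.
  move=> j0; have nj0 : (0 < n - j)%N by rewrite subn_gt0.
  have := congr1 up (Epos j j0); rewrite upM upD upM up_Frob up_c up_lin -mulrA.
  move/(local_annihilator pL qL (card_gt1 F) d0 nj0 lamd lami) => [B EB].
  rewrite -/T in EB; set E := (_ * _)%N in EB.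
  have le : (E <= M)%N.
    rewrite /E; case: (boolP (_ %| n - j)%N) => [w|_]; last by rewrite mul0n.
    have lt : (n - j < n)%N by rewrite ltn_subrL lt0n j0.
    rewrite mul1n; apply: (@leq_bigmax_cond _ _ (fun k : 'I_n => p ^ logn p k)%N (Ordinal lt)).
    by rewrite /= nj0.
  by exists (T ^+ (M - E) * B); rewrite -[in LHS](subnK le) exprD -mulrA EB mulrCA.
rewrite -/(up _) -/T Ea' -mulrA.
have [i0|i0] := eqVneq (i : nat) 0%N; last first.
  have [B EB] := kill_pos i i0; exists (T ^+ ((q ^ d - 1 %| n) * p ^ logn p n) * a' * B).
  rewrite exprD; set E := T ^+ (_ * _).
  transitivity (E * a' * (T ^+ M * up (mu i))); first by ring.
  by rewrite EB; ring.
have [B EB] : exists B, T ^+ M * up (\sum_(j < n | j != 0 :> nat) mu j * h j) = T ^+ e * B.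
  rewrite /up rmorph_sum mulr_sumr /=.
  apply: (big_ind (fun s => exists B, s = T ^+ e * B)).
  - by exists 0; rewrite mulr0.
  - by move=> _ _ [B1 ->] [B2 ->]; exists (B1 + B2); rewrite mulrDr.
  move=> j j0; have [B EB] := kill_pos j j0.
  by exists (B * up (h j)); rewrite -/(up _) upM mulrA EB mulrA.
(* Multiplying by [T ^+ M] moves the sum over j != 0 into the multiples of [T ^+ e], which restores
   the shape needed by [local_annihilator]. *)
have : (T ^+ M * up (mu i)) * lin1 ^+ n = Frob (T ^+ M * up (mu i))
    + T ^+ e * (T ^+ M * (c' * up (G i)) - B * lin1 ^+ n).
  have := congr1 up (E0 i i0); rewrite upM !upD upM up_Frob up_c up_lin.
  rewrite [Frob (T ^+ M * _)]rmorphM /= FrobT => E1.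
  have -> : T ^+ M * up (mu i) * lin1 ^+ n = T ^+ M * ((up (mu i)
      + up (\sum_(j < n | j != 0 :> nat) mu j * h j)) * lin1 ^+ n) - T ^+ e * B * lin1 ^+ n.
    by rewrite -EB; ring.
  by rewrite E1; ring.
move/(local_annihilator pL qL (card_gt1 F) d0 n0 lamd lami) => [B' EB'].
exists (a' * B'); rewrite -/T in EB' *.
by rewrite addnC exprD [RHS]mulrCA -EB'; ring.
Qed.

End RationalTorsion.

Lemma scalemxI (R : idomainType) m n (c : R) : c != 0 ->
  injective ( *:%R c : 'M[R]_(m, n) -> 'M[R]_(m, n)).
Proof.
move=> c0 A B E; apply/matrixP => i j; apply: (mulfI c0).
by move/matrixP/(_ i j): E; rewrite !mxE.
Qed.

(** * Descent of solutions from K[t] to A[t] *)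

Section Descent.
Variables (F : finFieldType) (K : closedFieldType).
Variable inK : {rmorphism {fraction {poly F}} -> K}.
Local Notation q := #|F|.
Local Notation Frob := (map_poly (comp_poly 'X^q)).
Local Notation lin1 := ('X - ('X^q)%:P).
Local Notation lin := ('X - (theta inK)%:P).
Local Notation untwist := (map_poly (frobq inK)).

HB.instance Definition _ := GRing.RMorphism.copy (embA inK) (inK \o @FracField.tofrac {poly F}).
HB.instance Definition _ := GRing.RMorphism.copy (embF inK) (embA inK \o polyC).
HB.instance Definition _ := GRing.RMorphism.copy (embAt inK) (map_poly (embA inK)).
HB.instance Definition _ := GRing.RMorphism.copy (embFt inK) (map_poly (embF inK)).

Lemma embA_inj : injective (embA inK).
Proof.
by move=> a b /fmorph_inj /eqP; rewrite tofrac_eq => /eqP.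
Qed.

(** Constants in [F] are fixed by the q-th power, so on A it is the substitution of theta^q.
    Untwisting thus becomes [Frob], which is defined without [K]. *)
Lemma frobq_embA a : frobq inK (embA inK a) = embA inK (a \Po 'X^q).
Proof.
have [p p_pr pF] := finPcharP F.
have qA : [pchar {poly F}].-nat q.
  have pA := rmorph_pchar (polyC : {rmorphism F -> {poly F}}) pF.
  by rewrite (eq_pnat _ (pcharf_eq pA)) (card_pprimeChar pF) pnatX pnat_id ?orbT.
rewrite /frobq -rmorphXn /=; congr (embA inK _).
elim/poly_ind: a => [|a b IH].
  by rewrite comp_poly0 expr0n gtn_eqF // ltnW ?card_gt1.
rewrite exprDn_pchar // exprMn IH comp_polyD comp_polyM comp_polyX comp_polyC.
by rewrite -polyC_exp expf_card.
Qed.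

Lemma untwist_embAt Z : untwist (embAt inK Z) = embAt inK (Frob Z).
Proof. by apply/polyP=> i; rewrite !coef_map /= frobq_embA. Qed.

Lemma embAt_in_t b : embAt inK (in_t b) = embFt inK b.
Proof. by apply/polyP=> i; rewrite !coef_map. Qed.

Lemma untwistK : cancel (twist inK) untwist.
Proof. by move=> f; apply/polyP=> i; rewrite !coef_map /= qrootK. Qed.

Lemma twistK : cancel untwist (twist inK).
Proof. by move=> f; apply/polyP=> i; rewrite !coef_map /= frobqK. Qed.

Lemma frobq_embF b : frobq inK (embF inK b) = embF inK b.
Proof. by rewrite /frobq -rmorphXn /= expf_card. Qed.

Lemma untwist_embFt b : untwist (embFt inK b) = embFt inK b.
Proof. by apply/polyP=> i; rewrite !coef_map /= frobq_embF. Qed.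

Lemma twist_embFt b : twist inK (embFt inK b) = embFt inK b.
Proof. by rewrite -{1}untwist_embFt twistK. Qed.

Lemma untwist_lin : untwist lin = embAt inK lin1.
Proof.
rewrite !rmorphB /= map_polyX map_polyC /= frobq_embA comp_polyX.
by rewrite [embAt inK 'X]map_polyX [embAt inK _%:P]map_polyC.
Qed.

Lemma embAt_inj : injective (embAt inK).
Proof.
move=> Z Z' E; apply/polyP=> i; apply: embA_inj.
by move/(congr1 (fun s : {poly K} => s`_i)): E; rewrite !coef_map.
Qed.

(* lin1^k is monic of positive degree in t while untwisting preserves degrees,
   so the coefficients of m are computed from the top down. *)
Lemma descent k (m : {poly K}) (B : {poly {poly F}}) : (0 < k)%N ->
  m * embAt inK lin1 ^+ k = untwist m + embAt inK B ->
  exists2 mu, m = embAt inK mu & mu * lin1 ^+ k = Frob mu + B.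
Proof.
move=> k0; have [s] := ubnP (size m); elim: s => // s IH in m B *; move=> szm E.
have [m0|m0] := eqVneq m 0.
  exists 0; first by rewrite m0 rmorph0.
  move: E; rewrite m0 mul0r rmorph0 add0r -[0](rmorph0 (embAt inK)) => /embAt_inj <-.
  by rewrite mul0r rmorph0 addr0.
have mon : embAt inK lin1 ^+ k \is monic.
  by rewrite -untwist_lin rmorphB /= map_polyX map_polyC /= monic_exp ?monicXsubC.
have szl : size (embAt inK lin1 ^+ k) = k.+1.
  by rewrite -untwist_lin rmorphB /= map_polyX map_polyC /= size_exp_XsubC.
set D := (size m).-1; have szD : size m = D.+1 by rewrite prednK ?size_poly_gt0.
(* The degree of [untwist m] is at most [D], below [D + k], so the top coefficient of the left side
   comes from [B]. *)
have lead : lead_coef m = embA inK B`_(D + k).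
  have szE : (size (m * embAt inK lin1 ^+ k)).-1 = (D + k)%N.
    by rewrite size_Mmonic // szl szD addSn addnS.
  rewrite -(lead_coef_Mmonic m mon) lead_coefE szE E coefD coef_map nth_default.
    by rewrite raddf0 add0r coef_map.
  by rewrite szD -addn1 leq_add2l.
set b := B`_(D + k) in lead; pose b1 := b%:P * 'X^D : {poly {poly F}}.
have Eb1 : embAt inK b1 = lead_coef m *: 'X^D.
  by rewrite rmorphM /= [embAt inK _%:P]map_polyC [embAt inK 'X^D]map_polyXn lead mul_polyC.
have [||mu Emu Eq] := IH (m - embAt inK b1) (B - (b1 * lin1 ^+ k - Frob b1)).
- apply: (@leq_ltn_trans D); last by rewrite -ltnS -szD.
  apply/leq_sizeP => j leDj; rewrite coefB Eb1 coefZ coefXn.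
  move: leDj; rewrite leq_eqVlt => /orP[/eqP <-|lt].
    by rewrite eqxx mulr1 lead_coefE subrr.
  by rewrite nth_default ?szD // (gtn_eqF lt) mulr0 subr0.
- have -> : embAt inK (B - (b1 * lin1 ^+ k - Frob b1)) = embAt inK B
      - (embAt inK b1 * embAt inK lin1 ^+ k - untwist (embAt inK b1)).
    by rewrite untwist_embAt -rmorphXn -rmorphM -!rmorphB.
  by rewrite mulrBl E [untwist (_ - _)]rmorphB /=; ring.
exists (mu + b1); first by rewrite rmorphD /= -Emu subrK.
by rewrite mulrDl Eq rmorphD /=; ring.
Qed.

Section Coordinates.
Variables (H : nat -> {poly {poly F}}) (n : nat).

Lemma mx_sigma_PhiM'_pos (u : 'rV[{poly K}]_n) (j : 'I_n) : j != 0 :> nat ->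
  mx_sigma inK (PhiM' inK H n) u 0 j = twist inK (u 0 j) * lin ^+ (n - j).
Proof.
move=> j0; rewrite mxE (bigD1 j) //= big1 ?addr0 => [|i ne].
  by rewrite !mxE (negPf j0) eqxx.
rewrite !mxE (negPf j0); case: ifP => _; first by rewrite mulr0.
by rewrite eq_sym (negPf ne) mulr0.
Qed.

Lemma mx_sigma_PhiM'_0 (u : 'rV[{poly K}]_n) (j : 'I_n) : j = 0 :> nat ->
  mx_sigma inK (PhiM' inK H n) u 0 j
  = twist inK (u 0 j + \sum_(i < n | i != 0 :> nat) u 0 i * embAt inK (H i.-1))
    * lin ^+ n.
Proof.
move=> j0; rewrite mxE (bigD1 j) //= rmorphD rmorph_sum mulrDl mulr_suml.
congr (_ + _); first by rewrite !mxE j0 eqxx.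
apply: eq_big => i; first by rewrite -val_eqE /= j0.
rewrite -val_eqE /= j0 => i0; rewrite !mxE (negPf i0) j0 eqxx.
by rewrite rmorphM mulrA.
Qed.

(** Untwisting the equation removes the q-th roots and makes [descent] apply to each entry of [u].
    Then [rational_torsion] gives a u = c u', and c can be cancelled from c a f = a (sigma u - u),
    because scalars in F_q[t] commute with sigma. *)
Lemma torsion_poly_kills p (c : {poly F}) (f u : 'rV[{poly K}]_n)
    (G : 'I_n -> {poly {poly F}}) :
  p \in [pchar F] -> c != 0 ->
  (forall j, f 0 j = twist inK (embAt inK (G j)) * lin ^+ (n - j)) ->
  embFt inK c *: f = mx_sigma inK (PhiM' inK H n) u - u ->
  exists u', embFt inK (torsion_poly F p n) *: f = mx_sigma inK (PhiM' inK H n) u' - u'.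
Proof.
move=> pF c0 Ef Eu.
have Euj j := congr1 (fun w : 'rV_n => w 0 j) Eu.
have unf j : untwist (f 0 j) = embAt inK (G j * lin1 ^+ (n - j)).
  rewrite Ef [LHS]rmorphM [RHS]rmorphM /= untwistK; congr (_ * _).
  by rewrite [LHS]rmorphXn [RHS]rmorphXn /= untwist_lin.
have Epos (i : 'I_n) : i != 0 :> nat -> exists mu, u 0 i = embAt inK mu /\
    mu * lin1 ^+ (n - i) = Frob mu + in_t c * (G i * lin1 ^+ (n - i)).
  move=> i0; have ni0 : (0 < n - i)%N by rewrite subn_gt0.
  have [|mu Emu Eq] := @descent _ (u 0 i) (in_t c * (G i * lin1 ^+ (n - i))) ni0.
    move: (congr1 untwist (Euj i)); rewrite mxE [in RHS]mxE [(- u) 0 i]mxE.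
    rewrite mx_sigma_PhiM'_pos // rmorphM rmorphB rmorphM rmorphXn /=.
    rewrite untwist_embFt unf untwistK untwist_lin => E2.
    by rewrite [embAt inK (in_t c * _)]rmorphM /= embAt_in_t E2 [RHS]addrC subrK.
  by exists mu.
have [mu0 Emu0] : exists mu : 'I_n -> {poly {poly F}}, forall i : 'I_n, i != 0 :> nat ->
    u 0 i = embAt inK (mu i) /\
    mu i * lin1 ^+ (n - i) = Frob (mu i) + in_t c * (G i * lin1 ^+ (n - i)).
  apply: (@fin_all_exists _ (fun=> {poly {poly F}}) (fun (i : 'I_n) mu =>
    i != 0 :> nat -> u 0 i = embAt inK mu /\
    mu * lin1 ^+ (n - i) = Frob mu + in_t c * (G i * lin1 ^+ (n - i)))) => i.
  have [i0|i0] := eqVneq (i : nat) 0%N; first by exists 0; rewrite i0.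
  by have [mu Emu] := Epos i i0; exists mu.
have Esum : \sum_(i < n | i != 0 :> nat) u 0 i * embAt inK (H i.-1)
    = embAt inK (\sum_(i < n | i != 0 :> nat) mu0 i * H i.-1).
  rewrite rmorph_sum; apply: eq_bigr => i i0.
  by rewrite rmorphM /= (proj1 (Emu0 i i0)).
set S := \sum_(i < n | _) mu0 i * _ in Esum.
(* Entry 0 involves the other entries through [S], so it descends only once [S] is known to lie in
   A[t]. *)
have E0 (i : 'I_n) : i = 0 :> nat -> exists mu, u 0 i = embAt inK mu /\
    (mu + S) * lin1 ^+ n = Frob mu + in_t c * (G i * lin1 ^+ n).
  move=> i0; have n0 : (0 < n)%N by apply: leq_ltn_trans (ltn_ord i).
  have [|mu Emu Eq] := @descent _ (u 0 i) (in_t c * (G i * lin1 ^+ n) - S * lin1 ^+ n) n0.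
    move: (congr1 untwist (Euj i)); rewrite mxE [in RHS]mxE [(- u) 0 i]mxE.
    rewrite mx_sigma_PhiM'_0 // Esum rmorphM rmorphB rmorphM rmorphXn /=.
    rewrite untwist_embFt unf i0 subn0 untwistK untwist_lin => E2.
    rewrite [embAt inK (in_t c * _ - _)]rmorphB /= [embAt inK (in_t c * _)]rmorphM /= embAt_in_t E2.
    by rewrite [embAt inK (S * _)]rmorphM /= [embAt inK (lin1 ^+ n)]rmorphXn /=; ring.
  by exists mu; split=> //; rewrite mulrDl Eq; ring.
have [mu Emu] : exists mu : 'I_n -> {poly {poly F}}, forall i : 'I_n, u 0 i = embAt inK (mu i) /\
    (mu i + (if i == 0 :> nat then S else 0)) * lin1 ^+ (n - i)
      = Frob (mu i) + in_t c * (G i * lin1 ^+ (n - i)).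
  apply: (@fin_all_exists _ (fun=> {poly {poly F}}) (fun (i : 'I_n) mu => u 0 i = embAt inK mu /\
    (mu + (if i == 0 :> nat then S else 0)) * lin1 ^+ (n - i)
      = Frob mu + in_t c * (G i * lin1 ^+ (n - i)))) => i.
  have [i0|i0] := eqVneq (i : nat) 0%N.
    by have [mu Emu] := E0 i i0; exists mu; rewrite i0 subn0.
  by have [mu Emu] := Epos i i0; exists mu; rewrite addr0.
(* The entries off 0 were chosen twice, first to form [S]; injectivity of [embAt] identifies the two
   choices. *)
have ES : S = \sum_(i < n | i != 0 :> nat) mu i * H i.-1.
  apply: eq_bigr => i i0; congr (_ * _); apply: embAt_inj.
  by rewrite -(proj1 (Emu0 i i0)) (proj1 (Emu i)).
have Hpos (i : 'I_n) : i != 0 :> nat ->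
    mu i * lin1 ^+ (n - i) = Frob (mu i) + in_t c * (G i * lin1 ^+ (n - i)).
  by move=> i0; have [_] := Emu i; rewrite (negPf i0) addr0.
have Hzero (i : 'I_n) : i = 0 :> nat ->
    (mu i + \sum_(j < n | j != 0 :> nat) mu j * H j.-1) * lin1 ^+ n
    = Frob (mu i) + in_t c * (G i * lin1 ^+ (n - i)).
  by move=> i0; have [_] := Emu i; rewrite i0 eqxx subn0 ES.
have [mu' Emu'] := fin_all_exists (rational_torsion (embF inK) pF c0 Hpos Hzero).
exists (\row_i embAt inK (mu' i)).
set a := torsion_poly F p n in Emu' *.
have cu : embFt inK c *: \row_i embAt inK (mu' i) = embFt inK a *: u.
  apply/rowP => i; rewrite !mxE (proj1 (Emu i)) -!embAt_in_t.
  by rewrite -rmorphM -rmorphM Emu'.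
have cK : embFt inK c != 0 by rewrite map_poly_eq0.
apply: (scalemxI cK).
rewrite scalerA mulrC -scalerA Eu !scalerBr -cu; congr (_ - _).
rewrite -{1}(twist_embFt a) -mx_sigmaZ -cu mx_sigmaZ.
by rewrite twist_embFt.
Qed.

End Coordinates.
End Descent.

(** * Extensions, Delta and rho *)

Section SkewAction.
Variables (R : nzRingType) (phi : {rmorphism R -> R}).

Lemma iter_rmorphD i : {morph iter i phi : x y / x + y}.
Proof. by elim: i => // i IH x y; rewrite !iterS IH rmorphD. Qed.

Lemma iter_rmorphM i : {morph iter i phi : x y / x * y}.
Proof. by elim: i => // i IH x y; rewrite !iterS IH rmorphM. Qed.

Lemma skew_eval_widen N (P : skew_poly phi) x : (size (skew_val P) <= N)%N ->
  skew_eval P x = \sum_(i < N) (skew_val P)`_i * iter i phi x.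
Proof.
move=> le; rewrite /skew_eval (big_ord_widen N (fun i => _`_i * iter i phi x) le).
rewrite big_mkcond; apply: eq_bigr => i _; case: ltnP => // ge.
by rewrite nth_default // mul0r.
Qed.

Lemma skew_evalDl (P Q : skew_poly phi) x :
  skew_eval (P + Q) x = skew_eval P x + skew_eval Q x.
Proof.
set N := maxn (size (skew_val P)) (size (skew_val Q)).
rewrite !(@skew_eval_widen N) ?leq_maxl ?leq_maxr ?size_polyD //.
by rewrite -big_split; apply: eq_bigr => i _; rewrite coefD mulrDl.
Qed.

Lemma skew_evalDr (P : skew_poly phi) x y :
  skew_eval P (x + y) = skew_eval P x + skew_eval P y.
Proof.
by rewrite -big_split; apply: eq_bigr => i _; rewrite iter_rmorphD mulrDr.
Qed.

Lemma skew_eval0l x : skew_eval (0 : skew_poly phi) x = 0.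
Proof. by rewrite /skew_eval size_poly0 big_ord0. Qed.

Lemma skew_eval_mono a i x : skew_eval (SkewPoly phi (a *: 'X^i)) x = a * iter i phi x.
Proof.
rewrite (@skew_eval_widen i.+1) /=; last first.
  by apply/leq_sizeP => j lt; rewrite coefZ coefXn gtn_eqF // mulr0.
rewrite big_ord_recr big1 /= ?add0r ?coefZ ?coefXn ?eqxx ?mulr1 // => j _.
by rewrite coefZ coefXn ltn_eqF // mulr0 mul0r.
Qed.

Lemma skew_ind (P : skew_poly phi -> Prop) :
  P 0 -> (forall x y, P x -> P y -> P (x + y)) ->
  (forall a i, P (SkewPoly phi (a *: 'X^i))) -> forall x, P x.
Proof.
move=> P0 PD PX [s]; rewrite -[s]coefK poly_def.
by apply: (big_ind (fun s => P (SkewPoly phi s))) => // x y; apply: PD.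
Qed.

Lemma skew_eval0r (P : skew_poly phi) : skew_eval P 0 = 0.
Proof. by apply: (addrI (skew_eval P 0)); rewrite -skew_evalDr !addr0. Qed.

(** By additivity in [P] and [Q] it is enough to compare monomials, where the iterates of [phi] are
    multiplicative. *)
Lemma skew_evalM (P Q : skew_poly phi) x :
  skew_eval (P * Q) x = skew_eval P (skew_eval Q x).
Proof.
elim/skew_ind: P => [|P1 P2 IH1 IH2|a i].
- by rewrite mul0r !skew_eval0l.
- by rewrite mulrDl !skew_evalDl IH1 IH2.
elim/skew_ind: Q => [|Q1 Q2 IH1 IH2|b j].
- by rewrite mulr0 !skew_eval0l skew_eval0r.
- by rewrite mulrDr !skew_evalDl skew_evalDr IH1 IH2.
rewrite [_ * _](_ : _ = SkewPoly phi ((a * iter i phi b) *: 'X^(i + j))); last first.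
  by apply: val_inj; apply: skew_mul_mono.
by rewrite !skew_eval_mono iter_rmorphM iterD mulrA.
Qed.

Lemma skew_evalC a x : skew_eval (skewC phi a) x = a * x.
Proof.
have -> : skewC phi a = SkewPoly phi (a *: 'X^0) by rewrite /skewC expr0 alg_polyC.
by rewrite skew_eval_mono.
Qed.

Lemma skew_eval_suml (I : finType) (P : I -> skew_poly phi) x :
  skew_eval (\sum_i P i) x = \sum_i skew_eval (P i) x.
Proof.
apply: (big_morph (fun P => skew_eval P x)); last exact: skew_eval0l.
by move=> ? ?; rewrite skew_evalDl.
Qed.

Lemma skew_eval_sumr (I : finType) (P : skew_poly phi) (x : I -> R) :
  skew_eval P (\sum_i x i) = \sum_i skew_eval P (x i).
Proof. exact: (big_morph _ (skew_evalDr P) (skew_eval0r P)). Qed.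

Lemma skew_mxactD m n (P Q : 'M[skew_poly phi]_(m, n)) w :
  skew_mxact (P + Q) w = skew_mxact P w + skew_mxact Q w.
Proof.
apply/colP => i; rewrite !mxE -big_split; apply: eq_bigr => j _.
by rewrite mxE skew_evalDl.
Qed.

Lemma skew_mxactM m n l (P : 'M[skew_poly phi]_(m, n)) (Q : 'M_(n, l)) w :
  skew_mxact (P *m Q) w = skew_mxact P (skew_mxact Q w).
Proof.
apply/colP => i; rewrite !mxE.
under eq_bigr => j _ do rewrite mxE skew_eval_suml.
rewrite exchange_big; apply: eq_bigr => j _; rewrite mxE skew_eval_sumr.
by apply: eq_bigr => k _; rewrite skew_evalM.
Qed.

Lemma skew_mxactC n a w : skew_mxact (skewC phi a *: 1%:M : 'M_n) w = a *: w.
Proof.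
apply/colP => i; rewrite !mxE (bigD1 i) //= big1 ?addr0 => [|j ne].
  by rewrite !mxE eqxx mulr1 skew_evalC.
by rewrite !mxE eq_sym (negPf ne) mulr0 skew_eval0l.
Qed.

End SkewAction.

(** * Extensions as rows modulo the image of sigma - 1 *)

Section Extensions.
Variables (F : finFieldType) (K : closedFieldType).
Variable inK : {rmorphism {fraction {poly F}} -> K}.
Variables (m : nat) (Phi : 'M[{poly K}]_m).
Local Notation sigma := (mx_sigma inK Phi).

Lemma mx_sigma_ext v (a : 'rV_m) (b : 'M_1) :
  mx_sigma inK (ext_mx Phi v) (row_mx a b)
  = row_mx (sigma a + map_mx (twist inK) b *m v) (map_mx (twist inK) b).
Proof.
by rewrite /mx_sigma map_row_mx mul_row_block mulmx0 add0r mulmx1.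
Qed.

Lemma mx_sigmaB x y : sigma (x - y) = sigma x - sigma y.
Proof. by rewrite /mx_sigma map_mxB mulmxBl. Qed.

(** An equivalence is the identity on M' and on the quotient, so it sends the last basis vector e to
    e + u; commuting with sigma at e is the stated relation. Conversely [u] defines a unipotent map,
    with inverse given by [- u]. *)
Lemma ext_row_equivP v1 v2 :
  ext_equiv (ext_row inK Phi v1) (ext_row inK Phi v2)
  <-> exists u, v1 - v2 = sigma u - u.
Proof.
split=> [[g [[gD gZ gS] _ gin gout]]|[u Eu]].
  pose e : frob_mx inK (ext_mx Phi v1) := row_mx 0 1%:M.
  have Ee : (g e : 'rV_(m + 1)) 0 (rshift m 0) = 1.
    by rewrite [LHS](gout e) /= /row_out row_mxEr mxE eqxx.
  exists (lsubmx (g e : 'rV_(m + 1))).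
  set u := lsubmx _.
  have Ege : g e = row_mx u 1%:M.
    rewrite -[LHS]hsubmxK; congr row_mx; apply/matrixP => i j.
    by rewrite !ord1 !mxE eqxx -Ee.
  have tw1 : map_mx (twist inK) 1%:M = 1%:M :> 'M_1 by rewrite map_mx1.
  have Ese : fm_sigma e = (row_mx v1 0 : 'rV_(m + 1)) + e.
    rewrite /= mx_sigma_ext tw1 mul1mx /e add_row_mx addr0 add0r.
    by rewrite /mx_sigma map_mx0 mul0mx add0r.
  have gin1 : g (row_mx v1 0) = row_mx v1 0 := gin v1.
  have := gS e; rewrite Ese gD gin1 Ege /= mx_sigma_ext tw1 mul1mx add_row_mx.
  case/eq_row_mx => E _.
  by apply: (addIr v2); rewrite subrK; apply: (addIr u); rewrite E addrAC subrK.
pose g (s : 'M_(1, m)) (w : 'rV[{poly K}]_(m + 1)) : 'rV_(m + 1) :=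
  row_mx (lsubmx w + rsubmx w *m s) (rsubmx w).
have gK s : cancel (g s) (g (- s)).
  move=> w; rewrite /g row_mxKl row_mxKr mulmxN addrK; exact: hsubmxK.
exists (g u); split.
- split=> [x y|c x|x] /=.
  + rewrite /g add_row_mx !linearD /= mulmxDl; congr row_mx.
    by rewrite addrACA.
  + by rewrite /g scale_row_mx !linearZ /= -scalemxAl scalerDr.
  rewrite -[x in LHS](hsubmxK (x : 'rV_(m + 1))) mx_sigma_ext /g mx_sigma_ext.
  rewrite row_mxKl row_mxKr; congr row_mx.
  set tr := map_mx _ _.
  have -> : sigma (lsubmx x + rsubmx x *m u) = sigma (lsubmx x) + tr *m sigma u.
    by rewrite mx_sigmaD; congr (_ + _); rewrite /mx_sigma map_mxM mulmxA.
  rewrite -!addrA -!mulmxDr; congr (_ + _ *m _).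
  by apply/eqP; rewrite -subr_eq addrAC Eu subrK.
- by exists (g (- u)) => //; have := gK (- u); rewrite opprK.
- by move=> x; rewrite /= /g /row_in row_mxKl row_mxKr mul0mx addr0.
by move=> x; rewrite /= /g /row_out row_mxEr mxE.
Qed.

(** [ext_scale] allows any representative [v'] of the class. Changing it alters c v' by c (sigma u -
    u), which is sigma (c u) - c u since twisting fixes F_q[t]. *)
Lemma ext_row_torsionP v :
  ext_torsion (ext_row inK Phi v)
  <-> exists2 c : {poly F}, c != 0 & exists u, embFt inK c *: v = sigma u - u.
Proof.
split=> [[c c0 [v' [/ext_row_equivP[u1 E1] /ext_row_equivP[u2 E2]]]]|[c c0 [u Eu]]].
  exists c => //; exists (embFt inK c *: u1 - u2).
  transitivity (embFt inK c *: (v - v') - (0 - embFt inK c *: v')).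
    by rewrite scalerBr sub0r opprK subrK.
  by rewrite E1 E2 mx_sigmaB mx_sigmaZ twist_embFt scalerBr !opprD addrACA.
exists c => //; exists v; split; apply/ext_row_equivP.
  by exists 0; rewrite /mx_sigma map_mx0 mul0mx !subrr.
exists (- u); rewrite -[- u]sub0r mx_sigmaB [X in X - _ - _](_ : _ = 0); last first.
  by rewrite /mx_sigma map_mx0 mul0mx.
by rewrite Eu !sub0r opprB opprK addrC.
Qed.

End Extensions.

(** * M' as a module over K[sigma], and the kernel of Delta *)

Section SigmaAction.
Variables (F : finFieldType) (K : closedFieldType).
Variable inK : {rmorphism {fraction {poly F}} -> K}.
Variables (H : nat -> {poly {poly F}}) (n : nat).
Local Notation sigma := (mx_sigma inK (PhiM' inK H n)).
Local Notation lin := ('X - (theta inK)%:P).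
Local Notation d := ((n * n.+1)./2).

(** Here [a] stands for the right-normal form with terms sigma^j a_j, so that multiplying it by ['X]
    is left multiplication by sigma. *)
Definition sigma_poly (a : {poly K}) (y : 'rV[{poly K}]_n) : 'rV[{poly K}]_n :=
  \sum_(j < size a) iter j sigma ((a`_j)%:P *: y).

Lemma sigma0 : sigma 0 = 0.
Proof. by rewrite /mx_sigma map_mx0 mul0mx. Qed.

Lemma iter_sigmaD j x y : iter j sigma (x + y) = iter j sigma x + iter j sigma y.
Proof. by elim: j => //= j ->; rewrite mx_sigmaD. Qed.

Lemma iter_sigma0 j : iter j sigma 0 = 0.
Proof. by elim: j => //= j ->; rewrite sigma0. Qed.

Lemma iter_sigma_embF j b x :
  iter j sigma ((embF inK b)%:P *: x) = (embF inK b)%:P *: iter j sigma x.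
Proof.
elim: j => //= j ->; rewrite mx_sigmaZ; congr (_ *: _).
have -> : (embF inK b)%:P = embFt inK b%:P by rewrite /embFt map_polyC.
by rewrite twist_embFt.
Qed.

Lemma sigma_poly_widen N (a : {poly K}) y : (size a <= N)%N ->
  sigma_poly a y = \sum_(j < N) iter j sigma ((a`_j)%:P *: y).
Proof.
move=> le; rewrite /sigma_poly (big_ord_widen N (fun j => iter j sigma ((a`_j)%:P *: y)) le).
rewrite big_mkcond; apply: eq_bigr => i _; case: ltnP => // ge.
by rewrite nth_default // scale0r iter_sigma0.
Qed.

Lemma sigma_polyD a b y : sigma_poly (a + b) y = sigma_poly a y + sigma_poly b y.
Proof.
set N := maxn (size a) (size b).
rewrite !(@sigma_poly_widen N) ?leq_maxl ?leq_maxr ?size_polyD //.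
rewrite -big_split; apply: eq_bigr => i _.
by rewrite coefD polyCD scalerDl iter_sigmaD.
Qed.

Lemma sigma_poly0 y : sigma_poly 0 y = 0.
Proof. by rewrite /sigma_poly size_poly0 big_ord0. Qed.

Lemma sigma_polyN a y : sigma_poly (- a) y = - sigma_poly a y.
Proof. by apply: (addrI (sigma_poly a y)); rewrite -sigma_polyD !subrr sigma_poly0. Qed.

Lemma sigma_sum (I : finType) (x : I -> 'rV[{poly K}]_n) :
  sigma (\sum_i x i) = \sum_i sigma (x i).
Proof. by apply: (big_morph _ _ sigma0) => y z; rewrite mx_sigmaD. Qed.

Lemma sigma_polyX a y : sigma_poly (a * 'X) y = sigma (sigma_poly a y).
Proof.
rewrite (@sigma_poly_widen (size a).+1); last first.
  by rewrite (leq_trans (size_polyMleq _ _)) // size_polyX addn2.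
rewrite big_ord_recl /= coefMX /= scale0r add0r sigma_sum.
by apply: eq_bigr => j _; rewrite coefMX /=.
Qed.

Lemma sigma_polyC c y : sigma_poly c%:P y = c%:P *: y.
Proof.
by rewrite (@sigma_poly_widen 1) ?size_polyC_leq1 // big_ord1 coefC.
Qed.

Lemma sigma_poly_embF b a y :
  sigma_poly ((embF inK b) *: a) y = (embF inK b)%:P *: sigma_poly a y.
Proof.
rewrite (@sigma_poly_widen (size a)) ?size_scale_leq // scaler_sumr.
by apply: eq_bigr => j _; rewrite coefZ polyCM -scalerA iter_sigma_embF.
Qed.

Definition sigma_comb (u : 'I_d -> {poly K}) : 'rV[{poly K}]_n :=
  \sum_i sigma_poly (u i) (nth 0 (nu_seq inK n) i).

Lemma sigma_combD u w : sigma_comb (fun i => u i + w i) = sigma_comb u + sigma_comb w.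
Proof. by rewrite -big_split; apply: eq_bigr => i _; rewrite sigma_polyD. Qed.

Lemma sigma_combN u : sigma_comb (fun i => - u i) = - sigma_comb u.
Proof. by rewrite -sumrN; apply: eq_bigr => i _; rewrite sigma_polyN. Qed.

Lemma sigma_combX u : sigma_comb (fun i => u i * 'X) = sigma (sigma_comb u).
Proof. by rewrite sigma_sum; apply: eq_bigr => i _; rewrite sigma_polyX. Qed.

Lemma sigma_comb_nu c (i : 'I_n) k : (k < n - i)%N ->
  exists u, sigma_comb u = (c%:P * lin ^+ k) *: delta_mx 0 i.
Proof.
move=> lt; set y := lin ^+ k *: delta_mx 0 i : 'rV[{poly K}]_n.
have : y \in nu_seq inK n.
  apply/flattenP; eexists; first by apply: map_f; exact: (mem_enum _ i).
  apply/mapP; exists (n - i - k.+1)%N; first by rewrite mem_iota; lia.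
  by rewrite /y; congr (lin ^+ _ *: _); lia.
case/(nthP 0) => j; rewrite size_nu_seq => ltj Ej.
exists (fun i => if i == Ordinal ltj then c%:P else 0).
rewrite /sigma_comb (bigD1 (Ordinal ltj)) //= big1 => [|i' /negPf ->]; last first.
  by rewrite sigma_poly0.
by rewrite eqxx addr0 sigma_polyC Ej scalerA.
Qed.

Lemma sigma_delta_pos (i : 'I_n) h : i != 0 :> nat ->
  exists b (i0 : 'I_n), i0 = 0 :> nat /\
  sigma (h *: delta_mx 0 i)
  = (twist inK h * lin ^+ (n - i)) *: delta_mx 0 i + b *: delta_mx 0 i0.
Proof.
move=> i_neq0; have n0 : (0 < n)%N by apply: leq_ltn_trans (ltn_ord i).
pose i0 := Ordinal n0.
have ne : i != i0 by apply: contraNneq i_neq0 => ->.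
exists (twist inK h * (twist inK (embAt inK (H i.-1)) * lin ^+ n)), i0; split=> //.
rewrite mx_sigmaZ [mx_sigma _ _ _](@frob_mx_sigma _ _ inK n (PhiM' inK H n) i).
rewrite (bigD1 i) //= (bigD1 i0) ?(eq_sym i0) //=.
rewrite big1 ?addr0 => [|j /andP[ji ji0]].
  by rewrite !mxE (negPf i_neq0) eqxx scalerDr !scalerA.
have j0 : (j == 0 :> nat) = false.
  by apply/negP => /eqP j0; case/eqP: ji0; apply: val_inj.
by rewrite !mxE (negPf i_neq0) j0 (negPf ji) scale0r.
Qed.

Lemma sigma_delta0 (i : 'I_n) h : i = 0 :> nat ->
  sigma (h *: delta_mx 0 i) = (twist inK h * lin ^+ n) *: delta_mx 0 i.
Proof.
move=> i0; rewrite mx_sigmaZ [mx_sigma _ _ _](@frob_mx_sigma _ _ inK n (PhiM' inK H n) i).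
rewrite (bigD1 i) //= big1 ?addr0 => [|j ji].
  by rewrite !mxE i0 eqxx scalerA.
have j0 : (j == 0 :> nat) = false.
  by apply/negP => /eqP j0; case/eqP: ji; apply: val_inj; rewrite /= i0.
by rewrite !mxE i0 eqxx j0 scale0r.
Qed.

(* A leading term c t^k is c (t - theta)^k for k < n - i, and otherwise
   c t^(k - (n - i)) (t - theta)^(n - i), which sigma produces from lower degree. *)
Lemma sigma_comb_delta_step (i : 'I_n) :
  (forall h, exists u, sigma_comb u
     = sigma (h *: delta_mx 0 i) - (twist inK h * lin ^+ (n - i)) *: delta_mx 0 i) ->
  forall g, exists u, sigma_comb u = g *: delta_mx 0 i.
Proof.
move=> step g; have [m] := ubnP (size g); elim: m => // m IH in g * => szg.
have [->|g0] := eqVneq g 0.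
  by exists (fun=> 0); rewrite scale0r /sigma_comb big1 // => j _; rewrite sigma_poly0.
set k := (size g).-1; have szk : size g = k.+1 by rewrite prednK ?size_poly_gt0.
set c := lead_coef g.
have mlin (l : nat) : lin ^+ l \is monic by rewrite monic_exp ?monicXsubC.
suff [g1 [mg1 szg1 [u1 Eu1]]] : exists g1 : {poly K}, [/\ g1 \is monic, size g1 = k.+1
     & exists u, sigma_comb u = (c%:P * g1) *: delta_mx 0 i].
  have [|u2 Eu2] := IH (g - c%:P * g1).
    apply: (@leq_ltn_trans k); last by rewrite -ltnS -szk.
    apply/leq_sizeP => j lekj; rewrite coefB coefCM.
    move: lekj; rewrite leq_eqVlt => /orP[/eqP <-|lt]; last first.
      by rewrite !nth_default ?szk ?szg1 // mulr0 subrr.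
    have -> : g1`_k = 1 by move: mg1; rewrite monicE lead_coefE szg1 => /eqP.
    by rewrite mulr1 /c lead_coefE subrr.
  exists (fun j => u1 j + u2 j); rewrite sigma_combD Eu1 Eu2 -scalerDl.
  by rewrite addrC subrK.
have [lt|ge] := ltnP k (n - i).
  exists (lin ^+ k); rewrite mlin size_exp_XsubC; split=> //.
  exact: sigma_comb_nu.
have ni0 : (0 < n - i)%N by rewrite subn_gt0.
exists ('X^(k - (n - i)) * lin ^+ (n - i)); split.
- by rewrite monicMl ?monicXn.
- by rewrite size_monicM ?monicXn ?monic_neq0 // size_polyXn size_exp_XsubC; lia.
(* The q-th power of [c] undoes the root taken by the twist; the degree of [h] is below [k] because
   [n - i > 0], so [IH] applies. *)
set h := (frobq inK c)%:P * 'X^(k - (n - i)) : {poly K}.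
have Eh : twist inK h = c%:P * 'X^(k - (n - i)).
  by rewrite rmorphM /= [twist _ _%:P]map_polyC /= frobqK [twist _ 'X^_]map_polyXn.
have [|u1 Eu1] := IH h.
  apply: (@leq_ltn_trans (k - (n - i)).+1); last by lia.
  rewrite (leq_trans (size_polyMleq _ _)) // size_polyXn.
  by have := size_polyC_leq1 (frobq inK c); case: (size _) => [|[]] //=; lia.
have [u2 Eu2] := step h.
exists (fun j => u1 j * 'X + - u2 j).
rewrite sigma_combD (sigma_combN u2) sigma_combX Eu1 Eu2 Eh mulrA.
by rewrite opprB addrC subrK.
Qed.

(** The line of x_0 is stable under sigma and is treated first; on the other x_i, sigma is diagonal
    up to multiples of x_0, which are then available. *)
Lemma sigma_comb_surj x : exists u, sigma_comb u = x.
Proof.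
have gen0 (i : 'I_n) g : i = 0 :> nat -> exists u, sigma_comb u = g *: delta_mx 0 i.
  move=> i0; apply: sigma_comb_delta_step => h; exists (fun=> 0).
  rewrite sigma_delta0 // i0 subn0 subrr /sigma_comb big1 // => j _.
  by rewrite sigma_poly0.
have gen (i : 'I_n) g : exists u, sigma_comb u = g *: delta_mx 0 i.
  have [i0|i0] := eqVneq (i : nat) 0%N; first exact: gen0.
  apply: sigma_comb_delta_step => h; have [b [j [j0 ->]]] := sigma_delta_pos h i0.
  by rewrite addrAC subrr add0r; apply: gen0.
rewrite [x]row_sum_delta.
apply: (big_ind (fun y => exists u, sigma_comb u = y)) => [||i _]; last exact: gen.
  by exists (fun=> 0); rewrite /sigma_comb big1 // => j _; rewrite sigma_poly0.
by move=> _ _ [u <-] [w <-]; exists (fun i => u i + w i); rewrite sigma_combD.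
Qed.

Section Delta.
Variable Delta : frob_mx inK (PhiM' inK H n) -> 'cV[K]_d.
Hypothesis hDelta : is_Delta Delta.

(** The sum of the coefficients of a right-normal form is its value at sigma = 1. *)
Lemma Delta_comb u : Delta (sigma_comb u) = \col_i (u i).[1].
Proof.
rewrite [LHS]hDelta; apply/colP => i; rewrite !mxE horner_coef.
by apply: eq_bigr => j _; rewrite expr1n mulr1.
Qed.

Lemma DeltaD x y : Delta (x + y) = Delta x + Delta y.
Proof.
have [u <-] := sigma_comb_surj x; have [w <-] := sigma_comb_surj y.
rewrite -sigma_combD !Delta_comb; apply/colP => i.
by rewrite !mxE hornerD.
Qed.

Lemma Delta_embF b x : Delta ((embF inK b)%:P *: x) = embF inK b *: Delta x.
Proof.
have [u <-] := sigma_comb_surj x.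
have -> : (embF inK b)%:P *: (sigma_comb u : 'rV_n)
    = sigma_comb (fun i => embF inK b *: u i).
  by rewrite scaler_sumr; apply: eq_bigr => i _; rewrite sigma_poly_embF.
by rewrite !Delta_comb; apply/colP => i; rewrite !mxE hornerZ.
Qed.

(** A right-normal form vanishing at 1 is divisible by ['X - 1] as an ordinary polynomial; since
    ['X] acts there as left multiplication by sigma, the form lies in (sigma - 1) K[sigma]. *)
Lemma Delta_eq0 x : Delta x = 0 <-> exists u, x = sigma u - u.
Proof.
have [u <-] := sigma_comb_surj x; rewrite Delta_comb; split=> [E0|[y Ey]].
  exists (sigma_comb (fun i => u i %/ ('X - 1%:P))).
  rewrite -sigma_combX -sigma_combN -sigma_combD; apply: eq_bigr => i _.
  congr (sigma_poly _ _); rewrite -[X in _ - X]mulr1 -mulrBr divpK // dvdp_XsubCl.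
  by apply/eqP; move/colP/(_ i): E0; rewrite !mxE.
have [w Ew] := sigma_comb_surj y.
rewrite -Delta_comb Ey -Ew -sigma_combX -sigma_combN -sigma_combD Delta_comb.
by apply/colP => i; rewrite !mxE hornerD hornerN hornerMX mulr1 subrr.
Qed.

(** Horner induction on [b], from the action of ['X] and of the constants; additivity of [Delta]
    joins the two. *)
Lemma rho_action (rho : {rmorphism {poly F} -> 'M[skew_poly (frobq inK)]_d}) :
  is_rho Delta rho ->
  forall b x, skew_mxact (rho b) (Delta x) = Delta (embFt inK b *: x).
Proof.
case=> rhoZ rhoX b; elim/poly_ind: b => [|b c IH] x.
  rewrite !rmorph0 scale0r.
  have /Delta_eq0 -> : exists u, 0 = sigma u - u by exists 0; rewrite sigma0 subrr.
  apply/colP => i; rewrite !mxE big1 // => j _.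
  by rewrite mxE skew_eval0l.
rewrite rmorphD rmorphM skew_mxactD [rho b * _]/(_ *m _) skew_mxactM -rhoX IH.
have -> : rho c%:P = skewC (frobq inK) (embF inK c) *: 1%:M.
  by rewrite -[c%:P]alg_polyC rhoZ rmorph1.
rewrite skew_mxactC -Delta_embF -DeltaD; congr (Delta _).
rewrite rmorphD rmorphM scalerDl /= [embFt inK 'X]map_polyX [embFt inK _%:P]map_polyC.
by rewrite scalerA.
Qed.

End Delta.
End SigmaAction.

(** The scalars lie in F_q[t] and are fixed by twisting, so they can be moved inside the twist. This
    is the shape of [f] assumed in [torsion_poly_kills]. *)
Lemma rowC_twist (F : finFieldType) (K : closedFieldType)
    (inK : {rmorphism {fraction {poly F}} -> K}) (H : nat -> {poly {poly F}})
    r s alpha beta0 gamma0 (j : 'I_(r + s)) :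
  exists G, rowC inK H r s alpha beta0 gamma0 0 j
    = twist inK (embAt inK G) * ('X - (theta inK)%:P) ^+ (r + s - j).
Proof.
have tw b : embFt inK b = twist inK (embAt inK (in_t b)).
  by rewrite embAt_in_t twist_embFt.
have twB x y : twist inK (embAt inK (x - y))
    = twist inK (embAt inK x) - twist inK (embAt inK y) by rewrite !raddfB.
have twM x y : twist inK (embAt inK (x * y))
    = twist inK (embAt inK x) * twist inK (embAt inK y).
  by rewrite [embAt inK _]rmorphM [LHS]rmorphM.
rewrite mxE; case: eqP => [->|_]; last first.
  by exists (in_t (alpha j) * H (r + s - j).-1); rewrite tw twM.
exists (in_t beta0 * H (r + s).-1 - in_t gamma0 * H r.-1 * H s.-1).
by rewrite subn0 !tw twB !twM mulrBl.
Qed.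

Theorem theorem5p6
  (p : nat) (F : finFieldType) (hp : p \in [pchar F])
  (K : closedFieldType) (inK : {rmorphism {fraction {poly F}} -> K})
  (algK : forall x : K, algebraicOver inK x)
  (H : nat -> {poly {poly F}}) (hH : anderson_thakur H)
  (r s : nat) (hr : (0 < r)%N) (hs : (0 < s)%N)
  (C : (r + s).-tuple {fraction {poly F}})
  (GammaC : {poly F})
  (hGammaC : is_lcm_denominators
     (C`_0 / (carlitzGamma F (r + s))%:F
      :: 1 / (carlitzGamma F r * carlitzGamma F s)%:F
      :: [seq C`_i / (carlitzGamma F i * carlitzGamma F (r + s - i))%:F
         | i <- iota 1 (r + s).-1]) GammaC)
  (alpha : nat -> {poly F}) (beta0 gamma0 : {poly F})
  (halpha : forall i : nat, (0 < i < r + s)%N ->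
     (alpha i)%:F =
     C`_i * GammaC%:F / (carlitzGamma F i * carlitzGamma F (r + s - i))%:F)
  (hbeta0 : beta0%:F = C`_0 * GammaC%:F / (carlitzGamma F (r + s))%:F)
  (hgamma0 : gamma0%:F = GammaC%:F / (carlitzGamma F r * carlitzGamma F s)%:F)
  (Delta : frob_mx inK (PhiM' inK H (r + s)) ->
     'cV[K]_(((r + s) * (r + s).+1)./2))
  (hDelta : is_Delta Delta)
  (rho : {rmorphism {poly F} ->
     'M[skew_poly (frobq inK)]_(((r + s) * (r + s).+1)./2)})
  (hrho : is_rho Delta rho) :
  let f := rowC inK H r s alpha beta0 gamma0 in
  let MC := ext_row inK (PhiM' inK H (r + s)) f in
  let vC := Delta (\sum_(i < r + s) f 0 i *: delta_mx 0 i) in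
  ext_torsion MC <->
  skew_mxact (rho (torsion_poly F p (r + s))) vC = 0.
Proof.
move=> f MC vC.
have -> : vC = Delta f by rewrite /vC -row_sum_delta.
(* The vector becomes [Delta] of a f, so both sides say that a multiple of [f] has the form sigma u
   - u: the multiple by a on one side, by some c != 0 on the other. *)
rewrite (rho_action hDelta hrho) (Delta_eq0 hDelta) ext_row_torsionP.
split=> [[c c0 [u Eu]]|[u Eu]]; last first.
  by exists (torsion_poly F p (r + s)); [exact: torsion_poly_neq0|exists u].
have [G EG] := fin_all_exists (@rowC_twist F K inK H r s alpha beta0 gamma0).
exact: (torsion_poly_kills hp c0 EG Eu).
Qed.
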